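(* Let $s\ge3$ be an integer, $T>0$, and let $(u,w,w_t)$ be a solution of the heat-wave system (HW) on $[0,T]$ which satisfies, with a finite constant $C$, the following three estimates (where $D^\alpha=\partial_{x_1}^\alpha$): $$\sup_{t\in[0,T]}\sum_{\alpha=0}^{s}\Big(\|D^\alpha u(t)\|_{L^2(\Omega_f)}^2+\|D^\alpha w_t(t)\|_{L^2(\Omega_s)}^2+\|D^\alpha w(t)\|_{H^1(\Omega_s)}^2\Big)+\int_0^T\sum_{\alpha=0}^{s}\|\nabla D^\alpha u(t)\|_{L^2(\Omega_f)}^2\,dt\le C,$$ $$\sup_{t\in[0,T]}\sum_{\alpha=0}^{s-1}\Big(\|D^\alpha u_t(t)\|_{L^2(\Omega_f)}^2+\|D^\alpha w_{tt}(t)\|_{L^2(\Omega_s)}^2+\|D^\alpha w_t(t)\|_{H^1(\Omega_s)}^2\Big)+\int_0^T\sum_{\alpha=0}^{s-1}\|\nabla D^\alpha u_t(t)\|_{L^2(\Omega_f)}^2\,dt\le C,$$ $$\sup_{t\in[0,T]}\sum_{\alpha=0}^{s-2}\Big(\|D^\alpha w_{ttt}(t)\|_{L^2(\Omega_s)}^2+\|D^\alpha w_{tt}(t)\|_{H^1(\Omega_s)}^2+\|D^\alpha u_{tt}(t)\|_{L^2(\Omega_f)}^2\Big)+\int_0^T\sum_{\alpha=0}^{s-2}\|\nabla D^\alpha u_{tt}(t)\|_{L^2(\Omega_f)}^2\,dt\le C.$$ Then $$w\in L^\infty(0,T;H^3(\Omega_s)),\qquad w_t\in L^\infty(0,T;H^2(\Omega_s)),\qquad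 u\in L^2(0,T;H^3(\Omega_f)).$$
   Context: **Geometry.** Let $L>0$, $0<h_1<h_2$, and let $\mathbb T^1_L$ be the one-dimensional torus of length $L$, with points $(x_1,x_2)\in\mathbb T^1_L\times(0,h_2)$. Put $\Omega_s=\mathbb T^1_L\times(0,h_1)$, $\Omega_f=\mathbb T^1_L\times(h_1,h_2)$, $\Gamma_s=\mathbb T^1_L\times\{h_1\}$, $\Gamma_f=\mathbb T^1_L\times\{h_2\}$, $\Gamma_{s,0}=\mathbb T^1_L\times\{0\}$. The unit normal on $\Gamma_s$ is $\nu=e_2$. All functions $u$ (on $\Omega_f$) and $w$ (on $\Omega_s$) are $\mathbb R^2$-valued; $L^2$, $H^s$ denote the corresponding spaces of $\mathbb R^2$-valued functions, with $\|v\|_{H^k(\Omega)}^2=\sum_{\alpha+b\le k}\|\partial_{x_1}^\alpha\partial_{x_2}^b v\|_{L^2(\Omega)}^2$. **System (HW).** $u_t-\Delta u=0$ in $(0,T)\times\Omega_f$; $w_{tt}-\Delta w+w=0$ in $(0,T)\times\Omega_s$; $u=0$ on $(0,T)\times\Gamma_f$; $w=0$ on $(0,T)\times\Gamma_{s,0}$; $u=w_t$ and $\partial_\nu u=\partial_\nu w$ on $(0,T)\times\Gamma_s$; with initial conditions $u(0)=u_0$, $w(0)=w_0$, $w_t(0)=w_1$. **Weak solution.** Put $V_f=\{v\in H^1(\Omega_f): v=0\text{ on }\Gamma_f\}$, $V_s=\{v\in H^1(\Omega_s): v=0\text{ on }\Gamma_{s,0}\}$, $\mathcal V=\{(\varphi_f,\varphi_s)\in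 V_f\times V_s:\varphi_f|_{\Gamma_s}=\varphi_s|_{\Gamma_s}\}$ (normed as a subspace of $H^1(\Omega_f)\times H^1(\Omega_s)$, with dual $\mathcal V'$), and $\mathbb H=L^2(\Omega_f)\times V_s\times L^2(\Omega_s)$. A solution $X=(u,w,w_t)$ on $[0,T]$ is understood in the weak sense: $X\in L^\infty(0,T;\mathbb H)$, $u\in L^2(0,T;H^1(\Omega_f))$, $\partial_t(u,w_t)\in L^2(0,T;\mathcal V')$, and for every $(\varphi_f,\varphi_s)\in\mathcal V$ and a.e. $t\in(0,T)$, $$\langle\partial_t(u,w_t)(t),(\varphi_f,\varphi_s)\rangle_{\mathcal V',\mathcal V}+(\nabla u(t),\nabla\varphi_f)_{L^2(\Omega_f)}+(\nabla w(t),\nabla\varphi_s)_{L^2(\Omega_s)}+(w(t),\varphi_s)_{L^2(\Omega_s)}=0 .$$ In particular the two interior equations hold in the sense of distributions. All space and time derivatives in the estimates are distributional derivatives, assumed to lie in the indicated spaces; suprema in $t$ may be read as essential suprema. *)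

(* Defs.v *)
From HB Require Import structures.
From mathcomp Require Import all_boot all_order all_algebra.
From mathcomp Require Import all_classical all_reals all_analysis measurable_realfun
  ess_sup_inf.
Set Implicit Arguments.
Unset Strict Implicit.
Unset Printing Implicit Defensive.
Import Order.TTheory GRing.Theory Num.Theory numFieldNormedType.Exports.
Local Open Scope classical_set_scope.
Local Open Scope ring_scope.

(* Conventions.
   - A function on the torus T_L is a function on R of which only the values on
     the fundamental domain [0, L[ matter; the topology of the torus enters
     through the test functions, which are L-periodic in x_1.
   - A point of a strip is x = (x_1, x_2) : R * R, a point of space-time is
     (t, x) : R * (R * R); R^2-valued functions are given by their two
     components, 'I_2 -> _ -> R.
   - The prefix sq_ denotes the square of a norm.
   - Lebesgue measure of the library lives on the Borel sigma-algebra: an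
     L^p class is represented by a Borel function. *)

Notation pt R := (measurableTypeR R * measurableTypeR R)%type.
Notation tpt R := (measurableTypeR R * pt R)%type.

(* The library's sigma-finiteness of product measures is not found by
   canonical structure inference, which leb2 and leb3 need. *)
Lemma product_measure_sigma_finite d1 d2 (T1 : measurableType d1)
    (T2 : measurableType d2) (R : realType)
    (m1 : {sigma_finite_measure set T1 -> \bar R})
    (m2 : {sigma_finite_measure set T2 -> \bar R}) :
  sigma_finite setT (m1 \x m2)%E.
Proof.
have /sigma_finiteP[F [TF ndF Foo]] := sigma_finiteT m1.
have /sigma_finiteP[G [TG ndG Goo]] := sigma_finiteT m2.
exists (fun n => F n `*` G n).
  rewrite -setXTT TF TG predeqE => -[x y]; split.
    move=> [/= [n _ Fnx] [k _ Gky]]; exists (maxn n k) => //; split.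
    - by move: x Fnx; exact/subsetPset/ndF/leq_maxl.
    - by move: y Gky; exact/subsetPset/ndG/leq_maxr.
  by move=> [n _ []/= ? ?]; split; exists n.
move=> k; have [? ?] := Foo k; have [? ?] := Goo k.
split; first exact: measurableX.
by rewrite product_measure1E// lte_mul_pinfty// ge0_fin_numE.
Qed.

Notation leb1 := (@lebesgue_measure _).

Definition leb2 {R : realType} :
    set (pt R) -> \bar R :=
  (@lebesgue_measure R \x @lebesgue_measure R)%E.

HB.instance Definition _ (R : realType) := Measure.on (@leb2 R).
HB.instance Definition _ (R : realType) :=
  Measure_isSigmaFinite.Build _ _ _ (@leb2 R)
    (product_measure_sigma_finite (@lebesgue_measure R) (@lebesgue_measure R)).
Definition leb3 {R : realType} :
    set (tpt R) -> \bar R :=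
  (@lebesgue_measure R \x @leb2 R)%E.
HB.instance Definition _ (R : realType) := Measure.on (@leb3 R).
HB.instance Definition _ (R : realType) :=
  Measure_isSigmaFinite.Build _ _ _ (@leb3 R)
    (product_measure_sigma_finite (@lebesgue_measure R) (@leb2 R)).

Notation vfield R := ('I_2 -> R * R -> R).
Notation tvfield R := ('I_2 -> R * (R * R) -> R).

Definition times (R : realType) (T : R) : set (measurableTypeR R) := `]0, T[.

Definition strip (R : realType) (L c d : R) : set (pt R) :=
  `[0, L[ `*` `]c, d[.

Definition cylinder (R : realType) (T L c d : R) : set (tpt R) :=
  times T `*` strip L c d.

Definition slice (R : realType) (v : tvfield R) (t : R) : vfield R :=
  fun i x => v i (t, x).

Fixpoint classC (R : realType) (V : normedModType R) (n : nat) (f : V -> R) :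
    Prop :=
  continuous f /\
  (if n is m.+1 then
     forall e : V, (forall x, derivable f x e) /\ classC m ('D_e f)
   else True).

Definition smooth (R : realType) (V : normedModType R) (f : V -> R) : Prop :=
  forall n, classC n f.

Definition pD (R : realType) (a b : nat) (f : R * R -> R) : R * R -> R :=
  iter a (fun g => 'D_((1, 0) : R * R) g)
    (iter b (fun g => 'D_((0, 1) : R * R) g) f).

Definition pDt (R : realType) (k a b : nat) (f : R * (R * R) -> R) :
    R * (R * R) -> R :=
  iter k (fun g => 'D_((1, (0, 0)) : R * (R * R)) g)
    (iter a (fun g => 'D_((0, (1, 0)) : R * (R * R)) g)
      (iter b (fun g => 'D_((0, (0, 1)) : R * (R * R)) g) f)).

Definition periodic1 (R : realType) (L : R) (f : R * R -> R) : Prop :=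
  forall x, f (x.1 + L, x.2) = f x.

Definition test1 (R : realType) (T : R) (f : R -> R) : Prop :=
  smooth f /\
  exists2 e : R, 0 < e & forall t, f t != 0 -> e <= t <= T - e.

Definition test2 (R : realType) (L c d : R) (f : R * R -> R) : Prop :=
  [/\ smooth f, periodic1 L f &
      exists2 e : R, 0 < e & forall x, f x != 0 -> c + e <= x.2 <= d - e].

Definition test3 (R : realType) (T L c d : R) (f : R * (R * R) -> R) : Prop :=
  [/\ smooth f, (forall t, periodic1 L (fun x => f (t, x))) &
      exists2 e : R, 0 < e & forall t x, f (t, x) != 0 ->
        (e <= t <= T - e) && (c + e <= x.2 <= d - e)].

Definition locint2 (R : realType) (L c d : R) (v : R * R -> R) : Prop :=
  forall e : R, 0 < e ->
    leb2.-integrable (`[0, L[ `*` `[c + e, d - e]) (EFin \o v).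

Definition locint3 (R : realType) (T L c d : R) (v : R * (R * R) -> R) : Prop :=
  forall e : R, 0 < e ->
    leb3.-integrable (`[e, T - e] `*` (`[0, L[ `*` `[c + e, d - e]))
      (EFin \o v).

(* g = partial_1^a partial_2^b v in the distributions on T_L x (c, d) *)
Definition is_wD (R : realType) (L c d : R) (a b : nat) (v g : R * R -> R) :
    Prop :=
  [/\ locint2 L c d v, locint2 L c d g &
      forall f, test2 L c d f ->
        \int[leb2]_(x in strip L c d) (v x * pD a b f x) =
        (-1) ^+ (a + b) * \int[leb2]_(x in strip L c d) (g x * f x)].

(* g = partial_t^k partial_1^a partial_2^b v in the distributions on
   (0, T) x T_L x (c, d) *)
Definition is_wDt (R : realType) (T L c d : R) (k a b : nat)
    (v g : R * (R * R) -> R) : Prop :=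
  [/\ locint3 T L c d v, locint3 T L c d g &
      forall f, test3 T L c d f ->
        \int[leb3]_(z in cylinder T L c d) (v z * pDt k a b f z) =
        (-1) ^+ (k + a + b) * \int[leb3]_(z in cylinder T L c d) (g z * f z)].

Definition sq_L2 (R : realType) (Om : set (pt R)) (v : vfield R) : \bar R :=
  (\sum_(i < 2) \int[leb2]_(x in Om) ((v i x) ^+ 2)%:E)%E.

Definition in_L2 (R : realType) (Om : set (pt R)) (v : vfield R) : Prop :=
  (forall i, measurable_fun Om (v i)) /\ (sq_L2 Om v < +oo)%E.

Definition ip_L2 (R : realType) (Om : set (pt R)) (v v' : vfield R) : R :=
  \sum_(i < 2) \int[leb2]_(x in Om) (v i x * v' i x).

(* v is in H^k(T_L x (c, d)), with derivatives
   D a b = partial_1^a partial_2^b v for a + b <= k *)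
Definition in_Hk (R : realType) (L c d : R) (k : nat) (v : vfield R)
    (D : nat -> nat -> vfield R) : Prop :=
  D 0 0 = v /\
  forall a b : nat, (a + b <= k)%N ->
    in_L2 (strip L c d) (D a b) /\
    forall i, is_wD L c d a b (v i) (D a b i).

Definition sq_Hk (R : realType) (Om : set (pt R)) (k : nat)
    (D : nat -> nat -> vfield R) : \bar R :=
  (\sum_(a < k.+1) \sum_(b < k.+1 | (a + b <= k)%N) sq_L2 Om (D a b))%E.

Definition ip_grad (R : realType) (Om : set (pt R))
    (D D' : nat -> nat -> vfield R) : R :=
  ip_L2 Om (D 1 0) (D' 1 0) + ip_L2 Om (D 0 1) (D' 0 1).

(* g is the trace on T_L x {y} (y = c or y = d) of the H^1 function with
   derivatives D: the trace operator is the extension by continuity of the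
   restriction of functions that are smooth up to the boundary. *)
Definition is_trace (R : realType) (L c d y : R) (D : nat -> nat -> vfield R)
    (g : 'I_2 -> R -> R) : Prop :=
  (forall i, measurable_fun (`[0, L[ : set (measurableTypeR R)) (g i)) /\
  exists f : nat -> vfield R,
    [/\ forall n i, smooth (f n i) /\ periodic1 L (f n i),
        sq_Hk (strip L c d) 1
          (fun a b i x => pD a b (f n i) x - D a b i x) @[n --> \oo] --> 0%E &
        (\sum_(i < 2) \int[leb1]_(x in `[0%R, L[)
           ((f n i (x, y) - g i x) ^+ 2)%:E)%E @[n --> \oo] --> 0%E].

Definition zero_trace (R : realType) (L c d y : R)
    (D : nat -> nat -> vfield R) : Prop :=
  is_trace L c d y D (fun _ _ => 0).

Definition in_V (R : realType) (L h1 h2 : R) (pf ps : vfield R)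
    (Df Ds : nat -> nat -> vfield R) : Prop :=
  [/\ in_Hk L h1 h2 1 pf Df /\ zero_trace L h1 h2 h2 Df,
      in_Hk L 0 h1 1 ps Ds /\ zero_trace L 0 h1 0 Ds &
      exists g, is_trace L h1 h2 h1 Df g /\ is_trace L 0 h1 h1 Ds g].

Definition dual_norm (R : realType) (L h1 h2 : R)
    (l : vfield R -> vfield R -> R) : \bar R :=
  ereal_sup [set y : \bar R | exists pf ps Df Ds,
    [/\ in_V L h1 h2 pf ps Df Ds,
        (sq_Hk (strip L h1 h2) 1 Df + sq_Hk (strip L 0 h1) 1 Ds <= 1)%E &
        y = `|l pf ps|%:E]].

Definition in_dual (R : realType) (L h1 h2 : R)
    (l : vfield R -> vfield R -> R) : Prop :=
  (forall (r : R) (pf ps qf qs : vfield R) Df Ds Ef Es,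
     in_V L h1 h2 pf ps Df Ds -> in_V L h1 h2 qf qs Ef Es ->
     l (fun i x => r * pf i x + qf i x) (fun i x => r * ps i x + qs i x) =
     r * l pf ps + l qf qs) /\
  (dual_norm L h1 h2 l < +oo)%E.

(* F = partial_t (u, z) in L^2(0, T; V'), where (u, z) is seen in V' through
   the L^2 pairing. As V' is separable, strong measurability is weak
   measurability, and the V'-valued distributional derivative may be tested
   against each element of V. *)
Definition is_dt (R : realType) (T L h1 h2 : R) (u z : tvfield R)
    (F : R -> vfield R -> vfield R -> R) : Prop :=
  [/\ forall t, times T t -> in_dual L h1 h2 (F t),
      forall pf ps Df Ds, in_V L h1 h2 pf ps Df Ds ->
        measurable_fun (times T) (fun t => F t pf ps),
      measurable_fun (times T) (fun t => dual_norm L h1 h2 (F t)),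
      (\int[leb1]_(t in times T) (dual_norm L h1 h2 (F t) ^+ 2) < +oo)%E &
      forall pf ps Df Ds th, in_V L h1 h2 pf ps Df Ds -> test1 T th ->
        \int[leb1]_(t in times T)
          (derive1 th t * (ip_L2 (strip L h1 h2) (slice u t) pf +
                       ip_L2 (strip L 0 h1) (slice z t) ps)) =
        - \int[leb1]_(t in times T) (th t * F t pf ps)].

(* t |-> v(t) is measurable and H^k-valued for almost every t, with
   derivatives D *)
Definition Hk_valued (R : realType) (T L c d : R) (k : nat) (v : tvfield R)
    (D : nat -> nat -> tvfield R) : Prop :=
  [/\ forall i, measurable_fun (cylinder T L c d) (v i),
      forall (a b : nat) i, (a + b <= k)%N ->
        measurable_fun (cylinder T L c d) (D a b i) &
      {ae leb1, forall t : measurableTypeR R, times T t ->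
        in_Hk L c d k (slice v t) (fun a b => slice (D a b) t)}].

(* Essential supremum over (0, T); the extension by 0 does not change it, as it
   is only used for f >= 0. *)
Definition esssup (R : realType) (T : R) (f : R -> \bar R) : \bar R :=
  ess_sup leb1 (patch (cst 0%E) (times T) f).

Definition Linf_bounded (R : realType) (T L c d : R) (k : nat)
    (D : nat -> nat -> tvfield R) : Prop :=
  (esssup T (fun t => sq_Hk (strip L c d) k (fun a b => slice (D a b) t))
   < +oo)%E.

Definition L2_bounded (R : realType) (T L c d : R) (k : nat)
    (D : nat -> nat -> tvfield R) : Prop :=
  (\int[leb1]_(t in times T)
     sq_Hk (strip L c d) k (fun a b => slice (D a b) t) < +oo)%E.

Definition in_LinfHk (R : realType) (T L c d : R) (k : nat) (v : tvfield R) :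
    Prop :=
  exists D, Hk_valued T L c d k v D /\ Linf_bounded T L c d k D.

Definition in_L2Hk (R : realType) (T L c d : R) (k : nat) (v : tvfield R) :
    Prop :=
  exists D, Hk_valued T L c d k v D /\ L2_bounded T L c d k D.

(* Weak solutions (u, w, z) of the heat-wave system, where z = w_t.
   The conditions u = 0 on Gamma_f and u = w_t on Gamma_s are not part of the
   weak formulation. *)
Definition weak_solution (R : realType) (T L h1 h2 : R)
    (u w z : tvfield R) : Prop :=
  [/\ in_LinfHk T L h1 h2 0 u,
      in_LinfHk T L 0 h1 0 z,
      forall i, is_wDt T L 0 h1 1 0 0 (w i) (z i) &
      exists Du Dw F,
      [/\ Hk_valued T L h1 h2 1 u Du /\ L2_bounded T L h1 h2 1 Du,
          Hk_valued T L 0 h1 1 w Dw /\ Linf_bounded T L 0 h1 1 Dw,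
          {ae leb1, forall t : measurableTypeR R, times T t ->
             zero_trace L 0 h1 0 (fun a b => slice (Dw a b) t)},
          is_dt T L h1 h2 u z F &
          forall pf ps Df Ds, in_V L h1 h2 pf ps Df Ds ->
            {ae leb1, forall t : measurableTypeR R, times T t ->
              F t pf ps
              + ip_grad (strip L h1 h2) (fun a b => slice (Du a b) t) Df
              + ip_grad (strip L 0 h1) (fun a b => slice (Dw a b) t) Ds
              + ip_L2 (strip L 0 h1) (slice w t) ps = 0}]].

Definition wDts (R : realType) (T L c d : R) (k a b : nat) (v : tvfield R) :
    set (tvfield R) :=
  [set g | forall i, is_wDt T L c d k a b (v i) (g i)].

(* || partial_t^k partial_1^a partial_2^b v (t) ||^2 in L^2(T_L x (c, d)), for
   the distributional derivative on (0, T) x T_L x (c, d); the value is +oo if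
   that derivative is not a function. *)
Definition sq_D (R : realType) (T L c d : R) (k a b : nat) (v : tvfield R)
    (t : R) : \bar R :=
  if `[< wDts T L c d k a b v !=set0 >] then
    sq_L2 (strip L c d) (slice (xget v (wDts T L c d k a b v)) t)
  else +oo%E.

(* || D^al partial_t^k v (t) ||^2 in H^1(T_L x (c, d)), D = partial_1 *)
Definition sq_DH1 (R : realType) (T L c d : R) (k al : nat) (v : tvfield R)
    (t : R) : \bar R :=
  (sq_D T L c d k al 0 v t + sq_D T L c d k al.+1 0 v t
   + sq_D T L c d k al 1 v t)%E.

(* || grad D^al partial_t^k v (t) ||^2 in L^2(T_L x (c, d)) *)
Definition sq_Dgrad (R : realType) (T L c d : R) (k al : nat) (v : tvfield R)
    (t : R) : \bar R :=
  (sq_D T L c d k al.+1 0 v t + sq_D T L c d k al 1 v t)%E.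

(* The estimate for k time derivatives of the solution, with tangential
   derivatives D^al, al = 0, ..., m *)
Definition energy_estimate (R : realType) (T L h1 h2 : R) (k m : nat)
    (u w : tvfield R) (C : R) : Prop :=
  (esssup T (fun t => \sum_(al < m.+1)
      (sq_D T L h1 h2 k al 0 u t + sq_D T L 0 h1 k.+1 al 0 w t
       + sq_DH1 T L 0 h1 k al w t))
   + \int[leb1]_(t in times T)
       \sum_(al < m.+1) sq_Dgrad T L h1 h2 k al u t <= C%:E)%E.

(* Main.v *)
Require Import Defs.
From mathcomp Require Import all_boot all_order all_algebra.
From mathcomp Require Import all_classical all_reals all_analysis.
From mathcomp Require Import measurable_realfun ess_sup_inf ring lra.
Set Implicit Arguments.
Unset Strict Implicit.
Unset Printing Implicit Defensive.
Import Order.TTheory GRing.Theory Num.Theory numFieldNormedType.Exports.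
Local Open Scope classical_set_scope.
Local Open Scope ring_scope.

(** The estimates bound the tangential derivatives of u and w and of some of
    their time derivatives, together with the same quantities differentiated
    once in x_2.  What is missing are the derivatives of order at least two in
    x_2, and these come from the equations: for almost every time t, in the
    distributions in x alone,
<<
      Laplacian of w   = w_tt  + w,
      Laplacian of w_t = w_ttt + w_t,
      Laplacian of u   = u_t.
>>
    If v is one of w, w_t, u and f is the corresponding right-hand side, then
    the derivative of order (a, b + 2) of v is the derivative of order (a, b)
    of f minus the derivative of order (a + 2, b) of v.  For a + b + 2 <= 3 (or
    <= 2 in the case of w_t) both terms are covered by the estimates, in
    L^oo(L^2) for w and w_t and in L^2(L^2) for u: only the derivatives
    in x_2 of u and u_t are restricted to L^2 in time.  This step is
    weak_laplacian_is_wD, and elliptic_regularity assembles the derivatives.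

    The work lies in passing from the hypotheses to statements about almost
    every time.  The derivatives in the estimates are distributions in
    space-time and the weak formulation holds for each test pair separately, so
    everything is tested with products th(t) f(x).  By Fubini's theorem this
    yields relations between the moments t |-> (v(t), f), which are
    distributional derivatives of one another on (0, T)
    (is_wDt_time_derivative, wave_moments, heat_moments); here f has compact
    support in the interior of one of the two strips, so that it has zero traces
    and, extended by 0 to the other strip, is admissible in the weak formulation.
    The fundamental lemma on (0, T) (time_derivative_unique) then identifies two
    functions of t at almost every time, for a fixed f.

    The exceptional null set depends on f.  It is made independent of f by
    separability (ae_forall_moment): the pairs consisting of a test function
    and one of its derivatives form a subset of a separable metric space for
    the uniform norm, hence countably many of them are dense, and both sides of
    an identity of moments are continuous for this norm since the functions of
    x involved are integrable.

    The order of the derivatives on test functions matters only once, when a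
    derivative in x_1 is moved across the two derivatives in x_2 of the
    Laplacian; this is the symmetry of second derivatives, derive_comm. *)

(** * Smooth functions and the symmetry of second derivatives *)

Section smooth_calculus.
Context {R : realType}.
Implicit Types V W : normedModType R.

Lemma classCS V n (f : V -> R) : classC n.+1 f -> classC n f.
Proof.
elim: n f => [|n IH] f [cf Df]; first by split.
split=> // e; have [? ?] := Df e; split=> //.
exact: IH.
Qed.

Lemma classCD V n (f g : V -> R) :
  classC n f -> classC n g -> classC n (fun x => f x + g x).
Proof.
elim: n f g => [|n IH] f g [cf Df] [cg Dg].
  by split=> // x; apply: continuousD; [exact: cf|exact: cg].
split=> [x|e]; first by apply: continuousD; [exact: cf|exact: cg].
have [df Cf] := Df e; have [dg Cg] := Dg e.
split=> [x|]; first exact: derivableD.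
rewrite (_ : 'D_e _ = (fun x => 'D_e f x + 'D_e g x)); first exact: IH.
by apply/funext => x; rewrite -deriveD.
Qed.

Lemma classCM V n (f g : V -> R) :
  classC n f -> classC n g -> classC n (fun x => f x * g x).
Proof.
elim: n f g => [|n IH] f g; first by move=> [cf _] [cg _];
  split=> // x; apply: continuousM; [exact: cf|exact: cg].
move=> Cf1 Cg1; have [cf Df] := Cf1; have [cg Dg] := Cg1.
split=> [x|e]; first by apply: continuousM; [exact: cf|exact: cg].
have [df Cf] := Df e; have [dg Cg] := Dg e.
split=> [x|]; first exact: derivableM.
rewrite (_ : 'D_e _ = (fun x => f x * 'D_e g x + g x * 'D_e f x)).
  by apply: classCD; apply: IH => //; exact: classCS.
by apply/funext => x; rewrite -[LHS]/('D_e (f * g) x) deriveM.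
Qed.

Lemma classC_cst V n (k : R) : classC n (fun _ : V => k).
Proof.
elim: n k => [|n IH] k; first by split=> // x; exact: cst_continuous.
split=> [x|e]; first exact: cst_continuous.
split=> [x|]; first exact: derivable_cst.
rewrite (_ : 'D_e _ = (fun=> 0)); first exact: IH.
by apply/funext => x; rewrite derive_cst.
Qed.

(** Along any direction the difference quotients of f \o l are difference
    quotients of f, so that the chain rule holds for the directional derivatives
    without total differentiability. *)
Section affine.
Context V W (l l' : V -> W).
Hypothesis lE : forall (h : R) e z, l (h *: e + z) = h *: l' e + l z.

Lemma derive_affine (f : W -> R) e z : 'D_e (f \o l) z = 'D_(l' e) f (l z).
Proof. by rewrite /derive; under eq_fun do rewrite /= lE. Qed.

Lemma derivable_affine (f : W -> R) e z :
  derivable f (l z) (l' e) -> derivable (f \o l) z e.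
Proof. by rewrite /derivable; under [in X in _ -> X]eq_fun do rewrite /= lE. Qed.

Lemma classC_affine n (f : W -> R) :
  continuous l -> classC n f -> classC n (f \o l).
Proof.
move=> cl; elim: n f => [|n IH] f [cf Df].
  by split=> // x; apply: continuous_comp; [exact: cl|exact: cf].
split=> [x|e]; first by apply: continuous_comp; [exact: cl|exact: cf].
have [df Cf] := Df (l' e); split=> [x|]; first exact: derivable_affine.
rewrite (_ : 'D_e _ = 'D_(l' e) f \o l); first exact: IH.
by apply/funext => x; rewrite derive_affine.
Qed.

End affine.

Lemma smooth_continuous V (f : V -> R) : smooth f -> continuous f.
Proof. by move=> /(_ 0)[]. Qed.

Lemma smooth_derivable V (f : V -> R) x e : smooth f -> derivable f x e.
Proof. by move=> /(_ 1)[_ /(_ e)[]]. Qed.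

Lemma smooth_derive V (f : V -> R) e : smooth f -> smooth ('D_e f).
Proof. by move=> Cf n; have [_ /(_ e)[]] := Cf n.+1. Qed.

Lemma smooth_iter V (f : V -> R) e n :
  smooth f -> smooth (iter n (fun g => 'D_e g) f).
Proof.
move=> Cf; elim: n => [|n IH]; first exact: Cf.
rewrite iterS; exact: (@smooth_derive V _ e IH).
Qed.

Lemma smooth_pD a b (f : R * R -> R) : smooth f -> smooth (pD a b f).
Proof. by move=> Cf; apply: smooth_iter; exact: smooth_iter. Qed.

Lemma smoothM V (f g : V -> R) :
  smooth f -> smooth g -> smooth (fun x => f x * g x).
Proof. by move=> Cf Cg n; exact: classCM. Qed.

Lemma smoothD V (f g : V -> R) :
  smooth f -> smooth g -> smooth (fun x => f x + g x).
Proof. by move=> Cf Cg n; exact: classCD. Qed.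

Lemma smooth_cst V (k : R) : smooth (fun _ : V => k).
Proof. by move=> n; exact: classC_cst. Qed.

(** The second difference of f along a and b equals, by the mean value theorem
    applied first along one direction and then along the other, h ^ 2 times a
    value of either mixed derivative at a point close to x. *)
Lemma second_difference V (f : V -> R) (a b x : V) (h : R) :
  smooth f -> 0 < h ->
  exists s t, [/\ 0 < s < h, 0 < t < h &
    f (h *: a + (h *: b + x)) - f (h *: a + x) - (f (h *: b + x) - f x)
    = 'D_b ('D_a f) (s *: a + (t *: b + x)) * h ^+ 2].
Proof.
move=> Cf h0.
have lE (c y : V) (k e z : R) :
    (k *: e + z) *: c + y = k *: (e *: c) + (z *: c + y).
  by rewrite scalerDl scalerA addrA.
have line (g : V -> R) (c y : V) (r : R) : smooth g ->
    is_derive r 1 (fun r => g (r *: c + y)) ('D_c g (r *: c + y)).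
  move=> Cg.
  have -> : 'D_c g (r *: c + y) = 'D_1 (g \o (fun r : R => r *: c + y)) r.
    rewrite (derive_affine (V := R) (l := fun r : R => r *: c + y)
      (l' := fun r : R => r *: c)).
      by rewrite scale1r.
    exact: lE.
  apply: derivableP.
  apply: (derivable_affine (V := R) (l := fun r : R => r *: c + y)
    (l' := fun r : R => r *: c)).
    exact: lE.
  exact: smooth_derivable.
have contd (g dg : R -> R) : (forall r : R, is_derive r (1 : R) g (dg r)) ->
    {within `[0, h], continuous g}.
  move=> dgP; apply: derivable_within_continuous => r _.
  by have [] := dgP r.
have d1 (r : R) : is_derive r (1 : R)
    (fun r => f (r *: a + (h *: b + x)) - f (r *: a + x))
    ('D_a f (r *: a + (h *: b + x)) - 'D_a f (r *: a + x)).
  by apply: is_deriveB; exact: line.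
have [s sh E1] := @MVT _ _ _ 0 h h0 (fun r _ => d1 r) (contd _ _ d1).
have d2 (r : R) : is_derive r (1 : R)
    (fun r => 'D_a f (r *: b + (s *: a + x)))
    ('D_b ('D_a f) (r *: b + (s *: a + x))).
  by apply: line; exact: smooth_derive.
have [t th E2] := @MVT _ _ _ 0 h h0 (fun r _ => d2 r) (contd _ _ d2).
exists s, t; split; [by move: sh; rewrite in_itv|by move: th; rewrite in_itv|].
move: E1 E2; rewrite !scale0r !add0r !subr0 => ->.
rewrite (addrCA (h *: b) (s *: a)) (addrCA (t *: b) (s *: a)) => ->.
by rewrite -mulrA -expr2.
Qed.

(** Dividing the two expressions of the second difference by h ^ 2 and letting
    h tend to 0 gives the same value, by continuity of the mixed derivatives. *)
Lemma derive_comm V (f : V -> R) (a b x : V) : smooth f ->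
  'D_a ('D_b f) x = 'D_b ('D_a f) x.
Proof.
move=> Cf; apply/eqP; rewrite -subr_eq0 -normr_le0; apply/ler_addgt0Pr => e e0.
rewrite add0r.
have e20 : 0 < e / 2 by rewrite divr_gt0.
have near_val (g : V -> R) : smooth g ->
    exists2 d : R, 0 < d & forall y, `|y - x| < d -> `|g x - g y| < e / 2.
  move=> Cg; have := @smooth_continuous _ _ Cg x.
  move/cvgrPdist_lt => /(_ _ e20)/nbhs_ballP[d /= d0 Hd].
  exists d => // y yx; apply: Hd; rewrite -ball_normE /=.
  by rewrite distrC.
have [d1 d10 H1] := near_val _ (smooth_derive b (smooth_derive a Cf)).
have [d2 d20 H2] := near_val _ (smooth_derive a (smooth_derive b Cf)).
(* Points s a + t b + x with s, t < h lie within the distance d1 and d2. *)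
pose N := `|a| + `|b| + 1.
have N0 : 0 < N by rewrite /N ltr_wpDl// addr_ge0.
pose h := Num.min d1 d2 / N.
have h0 : 0 < h by rewrite divr_gt0// lt_min d10.
have small s t : 0 < s < h -> 0 < t < h ->
    `|s *: a + (t *: b + x) - x| < Num.min d1 d2.
  move=> /andP[s0 sh] /andP[t0 th]; rewrite addrA addrK.
  rewrite (le_lt_trans (ler_normD _ _))// !normrZ !gtr0_norm//.
  rewrite (@le_lt_trans _ _ (h * (`|a| + `|b|)))//.
    by rewrite mulrDr lerD// ler_wpM2r// ltW.
  rewrite [ltRHS](_ : _ = h * N); last by rewrite /h divfK// gt_eqF.
  by rewrite ltr_pM2l// /N ltrDl.
have [s [t [sh th E1]]] := second_difference a b x Cf h0.
have [t' [s' [th' sh' E2]]] := second_difference b a x Cf h0.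
have E : 'D_b ('D_a f) (s *: a + (t *: b + x)) =
         'D_a ('D_b f) (t' *: b + (s' *: a + x)).
  have h2 : h ^+ 2 != 0 by rewrite expf_neq0// gt_eqF.
  apply: (mulIf h2); apply: etrans (esym E1) _; apply: etrans _ E2.
  rewrite (addrCA (h *: b) (h *: a) x) -!addrA; congr (_ + _).
  by rewrite !opprB addrA [RHS]addrC; congr (_ + _); rewrite addrC.
rewrite addrCA in E.
have := H1 (s *: a + (t *: b + x)); have := H2 (t' *: b + (s' *: a + x)).
have := small _ _ sh th; have := small _ _ sh' th'.
rewrite (addrCA (t' *: b)) !lt_min => /andP[_ h2'] /andP[h1' _].
move=> /(_ h2') A2 /(_ h1') A1.
rewrite (addrCA (t *: b)) in E; rewrite E (addrCA (t' *: b)) in A1.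
rewrite (_ : _ - _ = ('D_a ('D_b f) x - 'D_a ('D_b f) (s' *: a + (t' *: b + x)))
  - ('D_b ('D_a f) x - 'D_a ('D_b f) (s' *: a + (t' *: b + x)))); last first.
  by rewrite opprB addrA subrK.
apply: (le_trans (ler_normB _ _)); rewrite (splitr e); apply: lerD.
  exact: (ltW A2).
exact: (ltW A1).
Qed.

Lemma derive_iter_comm V (f : V -> R) a e e' : smooth f ->
  'D_e (iter a (fun g => 'D_e' g) f) = iter a (fun g => 'D_e' g) ('D_e f).
Proof.
move=> Cf; elim: a => [|a IH]; first by [].
rewrite !iterS -IH; apply/funext => x.
exact: (derive_comm e e' x (smooth_iter e' a Cf)).
Qed.

(** Moves two derivatives in x_2 to the outside, the form in which they occur
    in the Laplacian of the test function pD a b f. *)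
Lemma pD_add2 a b (f : R * R -> R) : smooth f ->
  pD a b.+2 f = pD 0 2 (pD a b f).
Proof.
move=> Cf; rewrite /pD !iterS /=.
have C2 := smooth_iter ((0, 1) : R * R) b Cf.
rewrite (derive_iter_comm a ((0, 1) : R * R) ((1, 0) : R * R) C2).
rewrite (derive_iter_comm a ((0, 1) : R * R) ((1, 0) : R * R)) //.
exact: (@smooth_derive _ _ ((0, 1) : R * R) C2).
Qed.

End smooth_calculus.

(** * Smooth bump functions *)

Section flat_functions.
Context {R : realType}.

(** The derivatives of exp (- 1 / x), extended by 0, are combinations of the
    functions flat k; so are the derivatives of each flat k, which makes all of
    them smooth at once. *)
Definition flat (k : nat) (x : R) : R :=
  if 0 < x then x^-1 ^+ k * expR (- x^-1) else 0.

Lemma flat_ge0 k x : 0 <= flat k x.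
Proof.
rewrite /flat; case: ifPn => // x0.
by rewrite mulr_ge0 ?expR_ge0// exprn_ge0// invr_ge0 ltW.
Qed.

(** The exponential series gives exp (1 / x) >= (1 / x) ^ (k + 1) / (k + 1)!,
    which beats the factor x ^ (- k) and leaves one power of x. *)
Lemma flat_le k x : flat k x <= (k.+1)`!%:R * `|x|.
Proof.
rewrite /flat; case: ifPn => [x0|_]; last by rewrite mulr_ge0.
have ix0 : 0 < x^-1 by rewrite invr_gt0.
rewrite expRN gtr0_norm// ler_pdivrMr ?expR_gt0//.
have := expR_ge1Dxn k (ltW ix0) => H.
rewrite -[leLHS]mul1r -[X in X * _](@mulfV _ (x * (k.+1)`!%:R)); last first.
  by rewrite mulf_neq0 ?gt_eqF// ltr0n fact_gt0.
rewrite [leLHS](_ : _ = k.+1`!%:R * x * (x^-1 ^+ k.+1 / k.+1`!%:R)).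
  by rewrite ler_pM2l ?mulr_gt0// ?ltr0n ?fact_gt0// (le_trans _ H)// lerDr.
rewrite exprS invfM; ring.
Qed.

Lemma flat0_le1 x : flat 0 x <= 1.
Proof.
rewrite /flat; case: ifPn => // x0.
by rewrite expr0 mul1r expR_le1 oppr_le0 invr_ge0 ltW.
Qed.

Lemma flat_gt0 k x : flat k x != 0 -> 0 < x.
Proof. by rewrite /flat; case: ifPn => //; rewrite eqxx. Qed.

Lemma is_derive_flat k (x : R) :
  is_derive x (1 : R) (flat k) (- k%:R * flat k.+1 x + flat k.+2 x).
Proof.
have [x0|x0|->] := ltgtP x 0.
- rewrite /flat ltNge (ltW x0)/= mulr0 addr0.
  apply: (@near_eq_is_derive _ _ _ (cst 0)).
    by near=> y; rewrite /cst ltNge ltW//=; near: y; exact: lt_nbhsl.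
- rewrite /flat x0.
  apply: (@near_eq_is_derive _ _ _ (fun y : R => y^-1 ^+ k * expR (- y^-1))).
    by near=> y; rewrite (_ : 0 < y)//; near: y; exact: lt_nbhsr.
  have dV : is_derive x (1 : R) (fun y : R => y^-1) (- x ^- 2 *: (1 : R)).
    by apply: is_deriveV; rewrite gt_eqF.
  have dN : is_derive x (1 : R) (fun y : R => - y^-1) (- (- x ^- 2 *: (1 : R))).
    exact: is_deriveN.
  have dX : is_derive x (1 : R) (fun y : R => y^-1 ^+ k)
      ((k%:R * x^-1 ^+ k.-1) *: (- x ^- 2 *: (1 : R))).
    rewrite (_ : (fun y => _) = (fun y : R => y^-1) ^+ k); last by rewrite exprfctE.
    exact: (@is_deriveX _ _ (fun y : R => y^-1) k).
  have dE : is_derive x (1 : R) (fun y : R => expR (- y^-1))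
      (- (- x ^- 2 *: (1 : R)) * expR (- x^-1)).
    rewrite mulrC; exact: (@is_derive1_comp _ expR (fun y : R => - y^-1)).
  have := @is_deriveM _ _ _ _ _ _ _ _ dX dE.
  move=> dM; apply: (@is_derive_eq _ _ _ _ _ _ _ _ dM).
  rewrite /GRing.scale/= !mulr1 -exprVn.
  case: k {dX dM} => [|k]; rewrite /= ?mul0r !exprS; ring.
- rewrite /flat ltxx mulr0 addr0.
  suff F : h^-1 *: ((flat k \o shift 0) (h *: (1 : R)) - flat k 0)
      @[h --> 0^'] --> (0 : R).
    apply: DeriveDef; first by apply/cvg_ex; exists 0.
    exact: cvg_lim.
  (* The difference quotient of flat k at 0 is flat k.+1, which tends to 0. *)
  have -> : (fun h => h^-1 *: ((flat k \o shift 0) (h *: (1 : R)) - flat k 0))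
      = flat k.+1.
    apply/funext => h; rewrite /= addr0 /GRing.scale/= mulr1 /flat ltxx subr0.
    by case: ifPn; rewrite ?mulr0// exprS mulrA.
  apply/cvgrPdist_lt => e e0; near=> h.
  rewrite sub0r normrN ger0_norm ?flat_ge0// (le_lt_trans (flat_le _ _))//.
  rewrite -ltr_pdivlMl ?ltr0n ?fact_gt0//.
  near: h; apply: dnbhs0_lt.
  by rewrite mulr_gt0// invr_gt0 ltr0n fact_gt0.
Unshelve. all: by end_near. Qed.

(** On the line one derivative direction is enough, as the others are
    multiples of it. *)
Lemma classCS_line n (f g : R -> R) :
  (forall x : R, is_derive x (1 : R) f (g x)) -> classC n g -> classC n.+1 f.
Proof.
move=> fg Cg.
have df x : differentiable f x by apply/derivable1_diffP; have [] := fg x.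
split=> [x|e]; first exact: differentiable_continuous.
split=> [x|]; first exact: diff_derivable.
rewrite (_ : 'D_e f = (fun x => e * g x)).
  by apply: classCM => //; exact: classC_cst.
apply/funext => x; have [_ <-] := fg x.
by rewrite !deriveE// -[X in 'd f x X = _]mulr1 -[LHS]/('d f x (e *: 1)) linearZ.
Qed.

Lemma smooth_flat k : smooth (flat k).
Proof.
move=> n; elim: n k => [|n IH] k.
  split=> // x; apply: differentiable_continuous; apply/derivable1_diffP.
  by have [] := is_derive_flat k x.
apply: (classCS_line (is_derive_flat k)).
by apply: classCD => //; apply: classCM => //; exact: classC_cst.
Qed.

(** Smooth functions supported in [a, b] that increase to the indicator
    function of ]a, b[, as exp (- 1 / y) increases to 1 when y tends to
    infinity. *)
Definition bump (a b : R) (n : nat) (t : R) : R :=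
  flat 0 (n.+1%:R * (t - a)) * flat 0 (n.+1%:R * (b - t)).

Lemma smooth_bump a b n : smooth (bump a b n).
Proof.
have aff (c d : R) : smooth (fun t : R => flat 0 (c * t + d)).
  move=> m; apply: (@classC_affine _ _ _ (fun t : R => c * t + d)
    (fun t : R => c * t)) (smooth_flat 0 m).
    by move=> h e z; rewrite /GRing.scale/=; ring.
  move=> x; apply: cvgD; last exact: cvg_cst.
  by apply: cvgM; [exact: cvg_cst|exact: cvg_id].
rewrite (_ : bump a b n = (fun t => flat 0 (n.+1%:R * t + - (n.+1%:R * a))
    * flat 0 (- n.+1%:R * t + n.+1%:R * b))).
  by apply: smoothM; exact: aff.
by apply/funext => t; rewrite /bump; congr (flat _ _ * flat _ _); ring.
Qed.

Lemma bump_supp a b n t : bump a b n t != 0 -> a < t < b.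
Proof.
rewrite /bump mulf_eq0 negb_or => /andP[/flat_gt0 + /flat_gt0].
by rewrite !pmulr_rgt0 ?ltr0n// !subr_gt0 => -> ->.
Qed.

Lemma bump_ge0 a b n t : 0 <= bump a b n t.
Proof. by rewrite mulr_ge0 ?flat_ge0. Qed.

Lemma bump_le1 a b n t : bump a b n t <= 1.
Proof. by rewrite mulr_ile1 ?flat_ge0 ?flat0_le1. Qed.

Lemma test1_bump T a b n : 0 < a -> b < T -> test1 T (bump a b n).
Proof.
move=> a0 bT; split; first exact: smooth_bump.
exists (Num.min a (T - b)); first by rewrite lt_min a0 subr_gt0.
move=> t /bump_supp/andP[at_ tb]; rewrite ge_min (ltW at_)/=.
by rewrite lerBrDr -lerBrDl ge_min orbC lerD2l lerN2 (ltW tb).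
Qed.

Lemma cvg_bump a b t : a < t < b -> bump a b n t @[n --> \oo] --> (1 : R).
Proof.
move=> /andP[at_ tb].
have F (y : R) : 0 < y -> flat 0 (n.+1%:R * y) @[n --> \oo] --> (1 : R).
  move=> y0; rewrite (_ : (fun n => _) =
      (fun n : nat => expR (- (y^-1 * harmonic n)))).
    rewrite -[X in _ --> X]expR0; apply: continuous_cvg.
      exact: continuous_expR.
    rewrite -oppr0; apply: cvgN; rewrite -(mulr0 y^-1).
    by apply: cvgM; [exact: cvg_cst|exact: cvg_harmonic].
  apply/funext => n; rewrite /flat mulr_gt0 ?ltr0n// expr0 mul1r.
  by rewrite invfM mulrC.
rewrite -[X in _ --> X]mulr1; apply: cvgM; apply: F; by rewrite subr_gt0.
Qed.

End flat_functions.

(** * The fundamental lemma on a time interval *)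

Section almost_everywhere.
Context d (T : measurableType d) (R : realType) (mu : {measure set T -> \bar R}).
Implicit Types P Q S : T -> Prop.

Lemma ae_imp P Q : (forall x, P x -> Q x) ->
  {ae mu, forall x, P x} -> {ae mu, forall x, Q x}.
Proof. by move=> PQ; apply: filterS. Qed.

Lemma ae_imp2 P Q S : (forall x, P x -> Q x -> S x) ->
  {ae mu, forall x, P x} -> {ae mu, forall x, Q x} -> {ae mu, forall x, S x}.
Proof. by move=> PQS; apply: filterS2. Qed.

End almost_everywhere.

Section fundamental_lemma.
Context {R : realType}.
Local Notation mu := (@lebesgue_measure R).

(** Local integrability in the open interval, in the style of locint2 and
    locint3. *)
Definition locint1 (T : R) (m : R -> R) : Prop :=
  forall e : R, 0 < e ->
    mu.-integrable (`[e, T - e] : set (measurableTypeR R)) (EFin \o m).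

Lemma measurable_itvR (i : interval R) :
  measurable ([set` i] : set (measurableTypeR R)).
Proof. exact: measurable_itv. Qed.

Lemma smooth_measurable (f : R -> R) (A : set (measurableTypeR R)) :
  smooth f -> measurable_fun A f.
Proof.
by move=> /smooth_continuous/continuous_measurable_fun; exact: measurable_funTS.
Qed.

Lemma locint1_oo (T : R) m (a b : R) : 0 < a -> b < T -> locint1 T m ->
  mu.-integrable (`]a, b[ : set (measurableTypeR R)) (EFin \o m).
Proof.
move=> a0 bT im; pose e := Num.min a (T - b).
have e0 : 0 < e by rewrite lt_min a0 subr_gt0.
apply: (integrableS _ _ _ (im _ e0)) => //; try exact: measurable_itvR.
move=> t /=; rewrite !in_itv/= => /andP[at_ tb].
rewrite ge_min (ltW at_)/= lerBrDr -lerBrDl ge_min orbC lerB//.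
exact: ltW.
Qed.

(** Integrating against the functions bump a b n and letting n tend to infinity
    shows that the integral over ]a, b[ vanishes. *)
Lemma Rintegral_oo_eq0 (T : R) m : locint1 T m ->
  (forall th, test1 T th -> \int[mu]_(t in times T) (th t * m t) = 0) ->
  forall a b : R, 0 < a -> b < T -> \int[mu]_(t in `]a, b[) m t = 0.
Proof.
move=> im m0 a b a0 bT; pose J : set (measurableTypeR R) := [set` `]a, b[].
have mJ : measurable J by exact: measurable_itvR.
have iJ := locint1_oo a0 bT im.
have mm : measurable_fun J m by apply/measurable_EFinP; exact: measurable_int iJ.
have JT : J `<=` times T.
  move=> t; rewrite /J /times /= !in_itv/= => /andP[at_ tb].
  by rewrite (lt_trans a0)//= (lt_trans tb).
have E n : (\int[mu]_(t in J) (bump a b n t * m t)%:E = 0)%E.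
  have iB : mu.-integrable J (EFin \o (fun t => bump a b n t * m t)).
    apply: (le_integrable _ _ _ iJ) => //.
      apply/measurable_EFinP; apply: measurable_funM => //.
      by apply: smooth_measurable; exact: smooth_bump.
    move=> t _ /=; rewrite lee_fin normrM ger0_norm ?bump_ge0//.
    by rewrite ler_piMl// bump_le1.
  rewrite -[LHS]fineK; last exact: integrable_fin_num.
  rewrite -[RHS]/(0%:E) -(m0 _ (test1_bump n a0 bT)).
  rewrite [in RHS]Rintegral_mkcond -/(Rintegral mu J _) [in LHS]Rintegral_mkcond.
  congr (_%:E); apply: eq_Rintegral => t _; rewrite !patchE.
  case: ifPn => tJ; first by rewrite mem_set//; exact/JT/set_mem.
  case: ifPn => // _; have [->|/bump_supp tab] := eqVneq (bump a b n t) 0.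
    by rewrite mul0r.
  by move: tJ; rewrite mem_set// /J /= in_itv.
have mf n : measurable_fun J (fun t => (bump a b n t * m t)%:E).
  apply/measurable_EFinP; apply: measurable_funM => //.
  by apply: smooth_measurable; exact: smooth_bump.
have cf : {ae mu, forall t : measurableTypeR R, J t ->
    (bump a b n t * m t)%:E @[n --> \oo] --> (m t)%:E}.
  apply: aeW => t tJ; apply: cvg_EFin; first exact: nearW.
  rewrite -[X in _ --> X]mul1r; apply: cvgM; last exact: cvg_cst.
  by apply: cvg_bump; move: tJ; rewrite /J /= in_itv.
have bf : {ae mu, forall (t : measurableTypeR R) n, J t ->
    (`|(bump a b n t * m t)%:E| <= `|(m t)%:E|)%E}.
  apply: aeW => t n _ /=; rewrite lee_fin normrM ger0_norm ?bump_ge0//.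
  by rewrite ler_piMl// bump_le1.
have [_ _] := dominated_convergence mJ mf (measurable_int _ iJ) cf
  (integrable_abse iJ) bf.
rewrite (_ : [sequence _]_n = fun=> 0%E); last by apply/funext => n; exact: E.
move=> /(cvg_unique (@ereal_hausdorff R) (cvg_cst (0%E : \bar R))) H.
by rewrite /Rintegral -H.
Qed.

(** The indefinite integral of the restriction of m to ]e, T - e] is zero, and
    so is its derivative, which is m almost everywhere there. *)
Lemma fundamental_lemma (T : R) m : locint1 T m ->
  (forall th, test1 T th -> \int[mu]_(t in times T) (th t * m t) = 0) ->
  {ae mu, forall t : measurableTypeR R, times T t -> m t = 0}.
Proof.
move=> im m0; have I0 := Rintegral_oo_eq0 im m0.
have key (k : nat) : {ae mu, forall t : measurableTypeR R,
    t \in `]k.+1%:R^-1, T - k.+1%:R^-1] -> m t = 0}.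
  set e : R := k.+1%:R^-1.
  have e0 : 0 < e by rewrite invr_gt0 ltr0n.
  pose J : set (measurableTypeR R) := [set` `]e, T - e]].
  have mJ : measurable J by exact: measurable_itvR.
  have iJ : mu.-integrable J (EFin \o m).
    apply: (integrableS _ _ _ (im _ e0)) => //.
    by move=> t; rewrite /J /= !in_itv/= => /andP[/ltW -> ->].
  have iT : mu.-integrable setT (EFin \o (m \_ J)).
    have := (@integrable_mkcond _ (measurableTypeR R) R mu J (EFin \o m) mJ).1 iJ.
    by rewrite restrict_EFin.
  have iy (y : R) : mu.-integrable (`]-oo, y] : set (measurableTypeR R))
      (EFin \o (m \_ J)).
    exact: (integrableS measurableT _ _ iT).
  have := @FTC1Ny _ (m \_ J) iy (integrable_locally mJ iJ).
  rewrite (_ : (fun x => _) = cst 0); last first.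
    apply/funext => y /=; rewrite -Rintegral_mkcondr.
    rewrite (_ : _ `&` _ = [set` `]e, Num.min y (T - e)]]); last first.
      apply/seteqP; split => t; rewrite /J /= !in_itv/= le_min.
        by move=> [-> /andP[-> ->]].
      by move=> /andP[-> /andP[-> ->]].
    have bT : Num.min y (T - e) < T by rewrite gt_min orbC ltrBlDr ltrDl e0.
    by rewrite -Rintegral_itv_bndo_bndc ?I0//; exact: (locint1_oo e0 bT im).
  move=> F; have : {ae mu, forall x : measurableTypeR R, (m \_ J) x = 0}.
    by apply: ae_imp F => x /= [_ <-]; rewrite derive1_cst.
  apply: ae_imp => t /=; rewrite patchE; case: ifPn => // tJ _.
  by move/negP: tJ => tJ te; case: tJ; rewrite mem_set.
have : {ae mu, forall t : measurableTypeR R, forall k : nat,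
    t \in `]k.+1%:R^-1, T - k.+1%:R^-1] -> m t = 0}.
  exact/ae_foralln.
apply: ae_imp => t tk; rewrite /times /= in_itv/= => /andP[t0 tT].
have d0 : 0 < Num.min t (T - t) by rewrite lt_min t0 subr_gt0.
have [k _ /(_ k (leqnn k)) /=] := near_infty_natSinv_lt (PosNum d0).
rewrite lt_min => /andP[k1 k2].
apply: (tk k); rewrite in_itv/= k1/= lerBrDr -lerBrDl; exact: ltW.
Qed.

End fundamental_lemma.

(** * Continuous functions on the plane *)

Section plane_functions.
Context {R : realType}.
Implicit Types (f : R * R -> R) (O : set (R * R)).

(** An open set of the plane is a countable union of squares with rational
    centre. *)
Lemma open_measurable2 O : open O -> measurable (O : set (pt R)).
Proof.
move=> oO.
pose sq (p q : rat) (n : nat) : set (pt R) :=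
  `](ratr p - n.+1%:R^-1 : R), ratr p + n.+1%:R^-1[ `*`
  `](ratr q - n.+1%:R^-1 : R), ratr q + n.+1%:R^-1[.
rewrite (_ : O = \bigcup_p \bigcup_q \bigcup_n
    [set x | (sq p q n `<=` O) /\ sq p q n x]); last first.
  apply/seteqP; split=> [x Ox|x [p _ [q _ [n _ [sO]]]]]; last exact: sO.
  have /nbhs_ballP[e /= e0 eO] : nbhs x O by exact: open_nbhs_nbhs.
  have e20 : 0 < e / 2 by rewrite divr_gt0.
  have [n _ /(_ n (leqnn n)) /= ne] := near_infty_natSinv_lt (PosNum e20).
  have dn : 0 < n.+1%:R^-1 :> R by rewrite invr_gt0 ltr0n.
  have [p] : exists p : rat, ratr p \in `]x.1 - n.+1%:R^-1, x.1 + n.+1%:R^-1[.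
    by apply: rat_in_itvoo; rewrite ltrBlDr -addrA ltrDl addr_gt0.
  have [q] : exists q : rat, ratr q \in `]x.2 - n.+1%:R^-1, x.2 + n.+1%:R^-1[.
    by apply: rat_in_itvoo; rewrite ltrBlDr -addrA ltrDl addr_gt0.
  rewrite !in_itv/= => /andP[q1 q2] /andP[p1 p2].
  exists p => //; exists q => //; exists n => //; split.
    have ne2 : n.+1%:R^-1 < e / 2 := ne.
    have close (r s t : R) : r - n.+1%:R^-1 < t -> t < r + n.+1%:R^-1 ->
        t - n.+1%:R^-1 < s -> s < t + n.+1%:R^-1 -> `|r - s| < e.
      move: ne2; set eta := n.+1%:R^-1.
      move=> ? ? ? ? ?; rewrite ltr_norml; apply/andP; split; lra.
    move=> y [] /=; rewrite !in_itv/= => /andP[y1 y2] /andP[y3 y4].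
    by apply: eO; split; rewrite /= /ball/=; [exact: (close _ _ (ratr p))|
      exact: (close _ _ (ratr q))].
  have flip (r t : R) : r - n.+1%:R^-1 < t -> t < r + n.+1%:R^-1 ->
      r \in `]t - n.+1%:R^-1, t + n.+1%:R^-1[.
    by move=> h1 h2; rewrite in_itv/=; apply/andP; rewrite ltrBlDr -[r < _]ltrBlDr.
  by split; apply: flip.
apply: bigcupT_measurable_rat => p; apply: bigcupT_measurable_rat => q.
apply: bigcupT_measurable => n.
have [h|h] := pselect (sq p q n `<=` O); last first.
  rewrite (_ : [set x | _] = set0)//; apply/seteqP; split=> // x [].
  by move=> /h.
rewrite (_ : [set x | _] = sq p q n); last first.
  by apply/seteqP; split=> // x [].
by apply: measurableX; exact: measurable_itvR.
Qed.

(** Measurability refers to the product of the Borel sigma-algebras, whence the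
    need for the countable unions of open_measurable2. *)
Lemma continuous_measurable2 f (A : set (pt R)) :
  continuous f -> measurable_fun A f.
Proof.
move=> /continuousP cf; apply: measurable_funTS.
apply: (measurability _ (RGenOpens.measurableE R)).
move=> _ [_ [a [b ->] <-]]; rewrite setTI; apply: open_measurable2.
exact/cf/interval_open.
Qed.

Lemma continuous_bounded2 f (a b c d : R) : continuous f ->
  exists2 M, 0 <= M & forall x, x.1 \in `[a, b] -> x.2 \in `[c, d] -> `|f x| <= M.
Proof.
move=> cf; pose K : set (R * R) := [set` `[a, b]] `*` [set` `[c, d]].
have cK : compact K by apply: compact_setX; exact: segment_compact.
have cfK : compact (f @` K).
  by apply: continuous_compact => //; exact: continuous_subspaceT.
have [M [_ HM]] := compact_bounded cfK.
exists (`|M| + 1); first by rewrite addr_ge0.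
move=> x x1 x2; apply: (HM (`|M| + 1)); last by exists x.
by rewrite (le_lt_trans (ler_norm M))// ltrDl.
Qed.

(** Heine-Cantor on a rectangle: near each of its points, all sufficiently
    small radii work, and compactness makes this uniform. *)
Lemma unif_continuous2 f (a b c d e : R) : continuous f -> 0 < e ->
  exists2 r : R, 0 < r & forall x y, x.1 \in `[a, b] -> x.2 \in `[c, d] ->
    `|x.1 - y.1| < r -> `|x.2 - y.2| < r -> `|f x - f y| < e.
Proof.
move=> cf e0; pose K : set (R * R) := [set` `[a, b]] `*` [set` `[c, d]].
have cK : compact K by apply: compact_setX; exact: segment_compact.
pose P (r : R) x := forall y, `|x.1 - y.1| < r -> `|x.2 - y.2| < r ->
  `|f x - f y| < e.
have e20 : 0 < e / 2 by rewrite divr_gt0.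
have : \forall r \near (0 : R)^'+, K `<=` P r.
  move/compact_near_coveringP: cK; apply => x Kx.
  have /cvgrPdist_lt/(_ _ e20)/nbhs_ballP[r /= r0 Hr] := cf x.
  have r20 : 0 < r / 2 by rewrite divr_gt0.
  exists (ball x (r / 2), [set r' | r' < r / 2]).
    by split; [exact: nbhsx_ballx|exact: nbhs_right_lt].
  move=> [z r'] /= [[]]; rewrite /ball/= => xz1 xz2 rr y zy1 zy2.
  have := Hr z; have := Hr y; rewrite /ball /= /prod_ball /ball/= => Hy Hz.
  have {}Hz : `|f x - f z| < e / 2.
    apply: Hz; split; apply: lt_le_trans (ltW _); eauto;
      by rewrite ltr_pdivrMr// ltr_pMr// ltr1n.
  have {}Hy : `|f x - f y| < e / 2.
    apply: Hy; split; rewrite (splitr r).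
      by rewrite (le_lt_trans (ler_distD z.1 _ _))// ltrD// (lt_trans zy1).
    by rewrite (le_lt_trans (ler_distD z.2 _ _))// ltrD// (lt_trans zy2).
  rewrite (le_lt_trans (ler_distD (f x) _ _))// (splitr e) ltrD//.
  by rewrite distrC.
move=> HK; near (0 : R)^'+ => r; exists r.
  by near: r; exact: nbhs_right_gt.
move=> x y x1 x2; have KP : K `<=` P r by near: r; exact: HK.
exact: KP.
Unshelve. all: by end_near. Qed.

End plane_functions.

(** * Fubini's theorem on a rectangle *)

Section rectangle_fubini.
Context d1 d2 (T1 : measurableType d1) (T2 : measurableType d2) (R : realType).
Context (m1 : {sigma_finite_measure set T1 -> \bar R})
        (m2 : {sigma_finite_measure set T2 -> \bar R}).
Context (D1 : set T1) (D2 : set T2) (mD1 : measurable D1) (mD2 : measurable D2).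
Variable f : T1 * T2 -> R.
Hypothesis intf : (m1 \x m2)%E.-integrable (D1 `*` D2) (EFin \o f).

Let g := (EFin \o f) \_ (D1 `*` D2).

Let mD : measurable (D1 `*` D2). Proof. exact: measurableX. Qed.

Let intg : (m1 \x m2)%E.-integrable setT g.
Proof. exact: ((integrable_mkcond (EFin \o f) mD).1 intf). Qed.

Let gE x : D1 x -> (fun y => g (x, y)) = (fun y => (f (x, y))%:E) \_ D2.
Proof.
move=> Dx; apply/funext => y; rewrite /g !patchE.
have [yD|yD] := boolP (y \in D2).
  by rewrite mem_set//; split => //=; exact: set_mem yD.
by rewrite memNset// => -[_ /= Dy]; move: yD; rewrite mem_set.
Qed.

Lemma ae_integrable_slice :
  {ae m1, forall x, D1 x -> m2.-integrable D2 (fun y => (f (x, y))%:E)}.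
Proof.
apply: ae_imp (ae_integrable1 intg) => x + Dx.
by rewrite (gE Dx) => /(integrable_mkcond _ mD2).2.
Qed.

Let F x := (\int[m2]_y g (x, y))%E.

Let FE x : D1 x -> F x = (\int[m2]_(y in D2) (f (x, y))%:E)%E.
Proof. by move=> Dx; rewrite /F gE// [RHS]integral_mkcond. Qed.

Let intF : m1.-integrable setT F.
Proof. exact: (integrable_fubini_F intg). Qed.

Let Ffin : {ae m1, forall x, D1 x -> (\int[m2]_(y in D2) f (x, y))%:E = F x}.
Proof.
apply: ae_imp ae_integrable_slice => x H Dx.
by rewrite FE// fineK//; apply: integrable_fin_num => //; exact: H.
Qed.

Let mF : measurable_fun D1 (fun x => \int[m2]_(y in D2) f (x, y)).
Proof.
apply: (@eq_measurable_fun _ _ _ _ _ (fine \o F)).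
  by move=> x /set_mem Dx; rewrite /= FE.
apply: measurable_funTS; apply: measurableT_comp => //.
exact: measurable_int intF.
Qed.

Lemma integrable_slice_integral :
  m1.-integrable D1 (EFin \o (fun x => \int[m2]_(y in D2) f (x, y))).
Proof.
apply/integrableP; split; first exact/measurable_EFinP.
have /integrableP[mF1 iF1] := integrableS measurableT mD1 (@subsetT _ _) intF.
apply: le_lt_trans iF1; rewrite le_eqVlt; apply/orP; left; apply/eqP.
apply: ae_eq_integral => //.
- by apply: measurableT_comp => //; exact/measurable_EFinP.
- exact: measurableT_comp.
- by apply: ae_imp Ffin => x H Dx; congr abse; exact: H.
Qed.

(** The inner integral may fail to be finite on a null set of x, where its
    real-valued version takes a default value. *)
Lemma Rintegral_rectangle :
  \int[(m1 \x m2)%E]_(z in D1 `*` D2) f z =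
  \int[m1]_(x in D1) \int[m2]_(y in D2) f (x, y).
Proof.
rewrite /Rintegral integral_mkcond -(integral12_prod_meas1 intg); congr fine.
transitivity (\int[m1]_(x in D1) F x)%E.
  rewrite [RHS]integral_mkcond; apply: eq_integral => x _; rewrite patchE.
  have [//|xD] := boolP (x \in D1).
  rewrite /fubini_F integral0_eq// => y _; rewrite /g patchE memNset// => -[/= Dx _].
  by move: xD; rewrite mem_set.
apply: ae_eq_integral => //.
- by apply: measurable_funTS; exact: measurable_int intF.
- exact/measurable_EFinP.
- by apply: ae_imp Ffin => x H Dx; apply/esym; exact: H.
Qed.

(** Integrating in the other order: used when the integral over the first
    variable vanishes identically. *)
Lemma Rintegral_rectangle_eq0 :
  (forall y, D2 y -> \int[m1]_(x in D1) (f (x, y))%:E = 0)%E ->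
  \int[(m1 \x m2)%E]_(z in D1 `*` D2) f z = 0.
Proof.
move=> f0; rewrite /Rintegral integral_mkcond -(integral21_prod_meas1 intg).
rewrite integral0_eq// => y _; rewrite /fubini_G.
have [Dy|Dy] := pselect (D2 y).
  rewrite -(f0 y Dy) [RHS]integral_mkcond; apply: eq_integral => x _.
  rewrite /g !patchE; have [xD|xD] := boolP (x \in D1).
    by rewrite mem_set//; split => //=; exact: set_mem xD.
  by rewrite memNset// => -[/= Dx _]; move: xD; rewrite mem_set.
by rewrite integral0_eq// => x _; rewrite /g patchE memNset// => -[].
Qed.

End rectangle_fubini.

(** * Test functions *)

Section test_functions.
Context {R : realType}.

Definition strip_band (c d : R) : set (R * R) := [set x | c <= x.2 <= d].

Lemma closed_strip_band c d : closed (strip_band c d).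
Proof.
rewrite (_ : strip_band c d = snd @^-1` [set` `[c, d]]).
  by apply: closed_comp; [move=> x _; exact: cvg_snd|exact: interval_closed].
by apply/seteqP; split => x; rewrite /= in_itv.
Qed.

(** Off a closed set S containing the support, f vanishes on a neighbourhood. *)
Lemma derive_supp (V : normedModType R) (S : set V) (f : V -> R) e :
  closed S -> (forall x, f x != 0 -> S x) -> forall x, 'D_e f x != 0 -> S x.
Proof.
move=> cS fS x Df; apply: contrapT => Sx; move/eqP: Df; apply.
rewrite (@near_eq_derive _ _ _ _ (cst 0)) ?derive_cst//.
have : nbhs x (~` S) by apply: open_nbhs_nbhs; split=> //; exact: closed_openC.
apply: filterS => y Sy; apply: contrapT => /eqP fy; exact/Sy/fS.
Qed.

Lemma test2_derive (L c d : R) f e : test2 L c d f -> test2 L c d ('D_e f).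
Proof.
move=> [Cf pf [r r0 fr]]; split.
- exact: smooth_derive.
- move=> x.
  have E : f = f \o (fun x => (x.1 + L, x.2)) by apply/funext => y; rewrite /= pf.
  rewrite [in RHS]E (@derive_affine _ _ _ (fun x => (x.1 + L, x.2)) id)//.
  by move=> h a b; rewrite /= -addrA.
- exists r => //; apply: derive_supp => //.
  exact: (@closed_strip_band (c + r) (d - r)).
Qed.

Lemma test2_pD (L c d : R) a b f : test2 L c d f -> test2 L c d (pD a b f).
Proof.
move=> tf; rewrite /pD.
have : test2 L c d (iter b (fun g => 'D_((0, 1) : R * R) g) f).
  by elim: b => [//|b IH]; rewrite iterS; exact: test2_derive.
move: (iter b _ f) => g tg.
by elim: a => [//|a IH]; rewrite iterS; exact: test2_derive.
Qed.

Lemma test1_derive (T : R) th n : test1 T th ->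
  test1 T (iter n (fun g : R -> R => 'D_(1 : R) g) th).
Proof.
move=> tth; elim: n => [//|n]; rewrite iterS; set g := iter _ _ _.
move=> [Cg [e e0 ge]]; split; first exact: smooth_derive.
exists e => //; apply: (@derive_supp _ [set` `[e, T - e]]).
  exact: interval_closed.
by move=> t /ge; rewrite /= in_itv.
Qed.

(** Testing with products is enough, since the relations obtained are used
    through their moments in x. *)
Definition tensor (th : R -> R) (f : R * R -> R) : R * (R * R) -> R :=
  fun z => th z.1 * f z.2.

Lemma smooth_tensor th f : smooth th -> smooth f -> smooth (tensor th f).
Proof.
move=> Ct Cf; apply: smoothM => n.
  by apply: (@classC_affine _ _ _ fst fst _ n th) => // x; exact: cvg_fst.
by apply: (@classC_affine _ _ _ snd snd _ n f) => // x; exact: cvg_snd.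
Qed.

Lemma derive_tensor th f (a : R) (e : R * R) : smooth th -> smooth f ->
  'D_(a, e) (tensor th f) = fun z =>
    th z.1 * 'D_e f z.2 + f z.2 * 'D_a th z.1.
Proof.
move=> Ct Cf; apply/funext => z.
rewrite -[LHS]/('D_(a, e) ((th \o fst) * (f \o snd)) z) deriveM.
- by rewrite (@derive_affine _ _ _ fst fst)// (@derive_affine _ _ _ snd snd).
- by apply: (@derivable_affine _ _ _ fst fst) => //; exact: smooth_derivable.
- by apply: (@derivable_affine _ _ _ snd snd) => //; exact: smooth_derivable.
Qed.

Lemma pDt_tensor k a b th f : smooth th -> smooth f ->
  pDt k a b (tensor th f) =
  tensor (iter k (fun g : R -> R => 'D_(1 : R) g) th) (pD a b f).
Proof.
move=> Ct Cf.
have space e n g : smooth g ->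
    iter n (fun g => 'D_((0, e) : R * (R * R)) g) (tensor th g) =
    tensor th (iter n (fun g => 'D_e g) g).
  move=> Cg; elim: n => [//|n IH]; rewrite !iterS IH derive_tensor//.
    by apply/funext => z; rewrite derive0 mulr0 addr0.
  exact: smooth_iter.
have time n g : smooth g ->
    iter n (fun g => 'D_((1, (0, 0)) : R * (R * R)) g) (tensor th g) =
    tensor (iter n (fun g : R -> R => 'D_(1 : R) g) th) g.
  move=> Cg; elim: n => [//|n IH]; rewrite !iterS IH derive_tensor//.
    apply/funext => z; rewrite -[(0, 0)]/(0 : R * R) derive0 mulr0 add0r.
    by rewrite mulrC.
  exact: smooth_iter.
rewrite /pDt (space (0, 1) b f Cf).
rewrite (space (1, 0) a _ (smooth_iter ((0, 1) : R * R) b Cf)).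
exact: (time k _ (smooth_pD a b Cf)).
Qed.

Lemma test3_tensor (T L c d : R) th f :
  test1 T th -> test2 L c d f -> test3 T L c d (tensor th f).
Proof.
move=> [Ct [e e0 te]] [Cf pf [r r0 fr]]; split.
- exact: smooth_tensor.
- by move=> t x; rewrite /tensor /= pf.
- exists (Num.min e r); first by rewrite lt_min e0.
  move=> t x; rewrite /tensor mulf_eq0 negb_or /= => /andP[/te/andP[t1 t2]].
  move=> /fr/andP[x1 x2].
  have m1 : Num.min e r <= e by rewrite ge_min lexx.
  have m2 : Num.min e r <= r by rewrite ge_min lexx orbT.
  by apply/andP; split; apply/andP; split; lra.
Qed.

End test_functions.

Section strip_integrals.
Context {R : realType}.
Variables L c d : R.
Hypotheses (L0 : 0 < L) (cd : c < d).

Lemma measurable_strip : measurable (strip L c d).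
Proof. by apply: measurableX; exact: measurable_itvR. Qed.

Lemma leb2_strip : (leb2 (strip L c d) < +oo)%E.
Proof.
rewrite /leb2 /strip product_measure1E//; try exact: measurable_itvR.
have itv (a b : R) x y : (@lebesgue_measure R
    [set` Interval (BSide x a) (BSide y b)] < +oo)%E.
  by rewrite lebesgue_measure_itv/=; case: ifPn => _; rewrite -?EFinB ltry.
apply: lte_mul_pinfty.
- exact: measure_ge0.
- by rewrite ge0_fin_numE; [exact: itv|exact: measure_ge0].
- exact: itv.
Qed.

Lemma integrable_continuous (f : R * R -> R) : continuous f ->
  leb2.-integrable (strip L c d) (EFin \o f).
Proof.
move=> cf; have [M M0 fM] := continuous_bounded2 0 L c d cf.
apply: measurable_bounded_integrable.
- exact: measurable_strip.
- exact: leb2_strip.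
- exact: continuous_measurable2.
- exists M; split; first exact: num_real.
  move=> r Mr x [/= x1 x2]; apply: le_trans (ltW Mr); apply: fM.
    by move: x1; rewrite !in_itv/= => /andP[-> /ltW].
  by move: x2; rewrite !in_itv/= => /andP[/ltW -> /ltW].
Qed.

Lemma integral_derive_line (a b : R) (g dg : R -> R) : a < b ->
  (forall x : R, is_derive x (1 : R) g (dg x)) -> continuous dg -> g a = g b ->
  (\int[lebesgue_measure]_(x in `[a, b]) (dg x)%:E = 0)%E.
Proof.
move=> ab dgP cdg gab.
have cg : continuous g.
  by move=> x; apply: differentiable_continuous; apply/derivable1_diffP;
    have [] := dgP x.
rewrite (@continuous_FTC2 _ dg g)//.
- by rewrite gab subee.
- exact: continuous_subspaceT.
- split.
  + by move=> x _; have [] := dgP x.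
  + by apply: cvg_at_right_filter; exact: cg.
  + by apply: cvg_at_left_filter; exact: cg.
- by move=> x _; rewrite derive1E; have [_ ->] := dgP x.
Qed.

Lemma is_derive_fst (f : R * R -> R) (r y : R) : smooth f ->
  is_derive r (1 : R) (fun r : R => f (r, y)) ('D_((1, 0) : R * R) f (r, y)).
Proof.
move=> Cf.
have lE (h k z : R) : (h *: k + z, y) = h *: ((k, 0) : R * R) + (z, y).
  by rewrite -[RHS]/(h *: k + z, h * 0 + y) mulr0 add0r.
rewrite -(@derive_affine _ R _ (fun r : R => (r, y)) (fun r : R => (r, 0)) lE f 1 r).
apply: derivableP.
apply: (@derivable_affine _ R _ (fun r : R => (r, y)) (fun r : R => (r, 0)) lE).
exact: smooth_derivable.
Qed.

Lemma is_derive_snd (f : R * R -> R) (x r : R) : smooth f ->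
  is_derive r (1 : R) (fun r : R => f (x, r)) ('D_((0, 1) : R * R) f (x, r)).
Proof.
move=> Cf.
have lE (h k z : R) : (x, h *: k + z) = h *: ((0, k) : R * R) + (x, z).
  by rewrite -[RHS]/(h * 0 + x, h *: k + z) mulr0 add0r.
rewrite -(@derive_affine _ R _ (fun r : R => (x, r)) (fun r : R => (0, r)) lE f 1 r).
apply: derivableP.
apply: (@derivable_affine _ R _ (fun r : R => (x, r)) (fun r : R => (0, r)) lE).
exact: smooth_derivable.
Qed.

Lemma continuous_pairl (g : R * R -> R) (x : R) :
  continuous g -> continuous (fun y : R => g (x, y)).
Proof.
move=> cg y; apply: (@continuous_comp _ _ _ (fun y : R => (x, y)) g).
  apply: (@cvg_pair _ _ _ _ (nbhs x) (nbhs y)); first exact: cvg_cst.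
  exact: cvg_id.
exact: cg.
Qed.

Lemma continuous_pairr (g : R * R -> R) (y : R) :
  continuous g -> continuous (fun x : R => g (x, y)).
Proof.
move=> cg x; apply: (@continuous_comp _ _ _ (fun x : R => (x, y)) g).
  apply: (@cvg_pair _ _ _ _ (nbhs x) (nbhs y)); last exact: cvg_cst.
  exact: cvg_id.
exact: cg.
Qed.

(** By the fundamental theorem of calculus on lines: in x_2 the function
    vanishes near both ends, in x_1 it takes the same value at both ends by
    periodicity. *)
Lemma Rintegral_derive_test2 (f : R * R -> R) (a b : nat) : test2 L c d f ->
  (a + b = 1)%N -> \int[leb2]_(x in strip L c d) pD a b f x = 0.
Proof.
move=> tf; have [Cf pf [r r0 fr]] := tf.
have iD := integrable_continuous (smooth_continuous (smooth_pD a b Cf)).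
have cD e : continuous ('D_e f) := smooth_continuous (smooth_derive e Cf).
case: a b iD => [|[|a]] [|[|b]]// iD _.
- rewrite /leb2 (Rintegral_rectangle _ _ iD); try exact: measurable_itvR.
  rewrite [X in _ = X](_ : 0 = \int[lebesgue_measure]_(x in `[0%R, L[) 0); last first.
    by rewrite Rintegral_cst ?mul0r//; exact: measurable_itvR.
  apply: eq_Rintegral => x _; rewrite /Rintegral -[RHS]/(fine 0%:E); congr fine.
  rewrite -(@integral_itv_bndoo _ c d _ true false); last first.
    apply/measurable_EFinP; apply: measurable_funTS.
    by apply: continuous_measurable_fun; apply: continuous_pairl; exact: cD.
  apply: (@integral_derive_line _ _ (fun y => f (x, y))
    (fun y => 'D_((0, 1) : R * R) f (x, y))) => //.
  + by move=> y; exact: is_derive_snd.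
  + exact: (@continuous_pairl ('D_((0, 1) : R * R) f) x (cD _)).
  + have z y : ~~ (c + r <= y <= d - r) -> f (x, y) = 0.
      by apply: contraNeq => /fr.
    by rewrite !z//; apply/negP => /andP[]; lra.
- apply: (Rintegral_rectangle_eq0 (measurable_itvR _) (measurable_itvR _) iD).
  move=> y _; rewrite integral_itv_bndo_bndc; last first.
    apply/measurable_EFinP; apply: measurable_funTS.
    by apply: continuous_measurable_fun; apply: continuous_pairr; exact: cD.
  apply: (@integral_derive_line _ _ (fun x => f (x, y))
    (fun x => 'D_((1, 0) : R * R) f (x, y))) => //.
  + by move=> x; exact: is_derive_fst.
  + exact: (@continuous_pairr ('D_((1, 0) : R * R) f) y (cD _)).
  + by have := pf (0, y); rewrite /= add0r.
Qed.

End strip_integrals.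

(** * Distributional derivatives in time *)

Section integral_complements.
Context d (T : measurableType d) (R : realType) (mu : {measure set T -> \bar R}).

Lemma integrable_support (K D : set T) (f : T -> R) :
  measurable K -> measurable D -> K `<=` D ->
  (forall x, D x -> ~ K x -> f x = 0) ->
  mu.-integrable K (EFin \o f) -> mu.-integrable D (EFin \o f).
Proof.
move=> mK mD KD f0 /(integrable_mkcond _ mK).1 iK.
apply/(integrable_mkcond _ mD).2; apply: eq_integrable iK => // x _.
rewrite !patchE; have [xK|xK] := boolP (x \in K).
  by rewrite mem_set//; apply/KD/set_mem.
case: ifPn => // /set_mem xD /=; rewrite f0// => Kx.
by move: xK; rewrite mem_set.
Qed.

Lemma integrable_bounded_mul (D : set T) (f g : T -> R) (M : R) :
  measurable D -> measurable_fun D g -> (forall x, D x -> `|g x| <= M) ->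
  mu.-integrable D (EFin \o f) -> mu.-integrable D (EFin \o (fun x => f x * g x)).
Proof.
move=> mD mg gM If.
have mf : measurable_fun D f by apply/measurable_EFinP; exact: measurable_int If.
apply: (le_integrable mD _ _ (integrableZl mD M If)).
  by apply/measurable_EFinP; exact: measurable_funM.
move=> x Dx /=; rewrite lee_fin !normrM mulrC ler_wpM2r//.
by rewrite (le_trans (gM x Dx))// ler_norm.
Qed.

Lemma ae_eq_Rintegral (D : set T) (f g : T -> R) : measurable D ->
  measurable_fun D f -> measurable_fun D g ->
  {ae mu, forall x, D x -> f x = g x} ->
  \int[mu]_(x in D) f x = \int[mu]_(x in D) g x.
Proof.
move=> mD mf mg fg; congr fine; apply: ae_eq_integral => //.
- exact/measurable_EFinP.
- exact/measurable_EFinP.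
- by apply: ae_imp fg => x /= H Dx; rewrite H.
Qed.

End integral_complements.

Section time_distributions.
Context {R : realType}.
Variable T : R.
Local Notation mu := (@lebesgue_measure R).
Local Notation dtn n th := (iter n (fun g : R -> R => 'D_(1 : R) g) th).
Implicit Types m : R -> R.

Lemma measurable_times : measurable (times T).
Proof. exact: measurable_itvR. Qed.

Lemma integrable_test1 th m : test1 T th -> locint1 T m ->
  mu.-integrable (times T) (EFin \o (fun t => th t * m t)).
Proof.
move=> [Ct [e e0 te]] im.
have cth := smooth_continuous Ct.
have mth (A : set (measurableTypeR R)) : measurable_fun A th.
  exact: smooth_measurable.
have : compact (th @` [set` `[e, T - e]]).
  apply: continuous_compact; last exact: segment_compact.
  exact: continuous_subspaceT.
move=> /compact_bounded[M [_ HM]].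
apply: (@integrable_support _ (measurableTypeR R) R mu [set` `[e, T - e]]).
- exact: measurable_itvR.
- exact: measurable_times.
- move=> t; rewrite /times /= !in_itv/= => /andP[et tT].
  by rewrite (lt_le_trans e0)//= (le_lt_trans tT)// ltrBlDr ltrDl.
- move=> t _ nt; have [->|/te te'] := eqVneq (th t) 0; first by rewrite mul0r.
  by case: nt; rewrite /= in_itv.
- rewrite (_ : (fun t => _) = (fun t => m t * th t)); last first.
    by apply/funext => t; rewrite mulrC.
  apply: (@integrable_bounded_mul _ (measurableTypeR R) R mu _ _ _ (M + 1)) => //.
  + by move=> t tI; apply: HM; rewrite ?ltrDl//; exists t.
  + exact: im.
Qed.

Lemma locint1D m1 m2 : locint1 T m1 -> locint1 T m2 ->
  locint1 T (fun t => m1 t + m2 t).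
Proof.
move=> i1 i2 e e0; have := integrableD (measurable_itvR _) (i1 e e0) (i2 e e0).
by apply: eq_integrable; first exact: measurable_itvR.
Qed.

Lemma locint1Z k m : locint1 T m -> locint1 T (fun t => k * m t).
Proof.
move=> i1 e e0; have := integrableZl (measurable_itvR _) k (i1 e e0).
by apply: eq_integrable; first exact: measurable_itvR.
Qed.

(** Local integrability of both functions is part of the notion, so that sums
    and multiples can be formed under the integral. *)
Definition time_derivative (k : nat) (m m' : R -> R) : Prop :=
  [/\ locint1 T m, locint1 T m' & forall th, test1 T th ->
    \int[mu]_(t in times T) (dtn k th t * m t) =
    (-1) ^+ k * \int[mu]_(t in times T) (th t * m' t)].

Lemma time_derivativeD k m1 m1' m2 m2' :
  time_derivative k m1 m1' -> time_derivative k m2 m2' ->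
  time_derivative k (fun t => m1 t + m2 t) (fun t => m1' t + m2' t).
Proof.
move=> [i1 i1' E1] [i2 i2' E2]; split; try exact: locint1D.
move=> th tth; have tk := test1_derive k tth.
under eq_Rintegral do rewrite mulrDr.
rewrite RintegralD; try exact: integrable_test1; last exact: measurable_times.
under [in RHS]eq_Rintegral do rewrite mulrDr.
rewrite [in RHS]RintegralD; try exact: integrable_test1;
  last exact: measurable_times.
by rewrite E1// E2// mulrDr.
Qed.

Lemma time_derivativeZ k (r : R) m m' : time_derivative k m m' ->
  time_derivative k (fun t => r * m t) (fun t => r * m' t).
Proof.
move=> [i i' E]; split; try exact: locint1Z.
move=> th tth; have tk := test1_derive k tth.
under eq_Rintegral do rewrite mulrCA.
rewrite RintegralZl; try exact: integrable_test1; last exact: measurable_times.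
under [in RHS]eq_Rintegral do rewrite mulrCA.
rewrite [in RHS]RintegralZl; try exact: integrable_test1;
  last exact: measurable_times.
by rewrite E// mulrCA.
Qed.

Lemma time_derivative_unique k m m1 m2 :
  time_derivative k m m1 -> time_derivative k m m2 ->
  {ae mu, forall t : measurableTypeR R, times T t -> m1 t = m2 t}.
Proof.
move=> [_ i1 E1] [_ i2 E2].
have iB : locint1 T (fun t => m1 t + -1 * m2 t).
  by apply: locint1D => //; exact: locint1Z.
have := fundamental_lemma iB.
have H : forall th, test1 T th ->
    \int[mu]_(t in times T) (th t * (m1 t + -1 * m2 t)) = 0.
  move=> th tth; under eq_Rintegral do rewrite mulN1r mulrBr.
  rewrite RintegralB; try exact: integrable_test1; last exact: measurable_times.
  apply/eqP; rewrite subr_eq0; apply/eqP.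
  have s0 : (-1) ^+ k != 0 :> R by rewrite expf_neq0// oppr_eq0 oner_eq0.
  by apply: (mulfI s0); rewrite -E1// -E2.
move=> /(_ H); apply: ae_imp => t /[apply] /eqP.
by rewrite mulN1r subr_eq0 => /eqP.
Qed.

(** The first relation is tested with the k-th derivative of a test function. *)
Lemma time_derivative_cancel j k m m1 m2 : time_derivative j m m1 ->
  time_derivative (j + k) m m2 -> time_derivative k m1 m2.
Proof.
move=> [_ i1 E1] [_ i2 E2]; split => // th tth.
have := E1 _ (test1_derive k tth); rewrite -iterD E2// exprD -mulrA => E.
have s0 : (-1) ^+ j != 0 :> R by rewrite expf_neq0// oppr_eq0 oner_eq0.
exact/esym/(mulfI s0).
Qed.

End time_distributions.

(** * Moments of a space-time function *)

Section moments.
Context {R : realType}.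
Variables T L c d : R.
Local Notation mu := (@lebesgue_measure R).
Implicit Types (v g : R * (R * R) -> R) (f : R * R -> R).

(** Tested with th(t) f(x), a distribution on (0, T) x strip becomes the
    distribution on (0, T) given by its moment. *)
Definition moment v f (t : R) : R := \int[leb2]_(x in strip L c d) (v (t, x) * f x).

(** The subcylinders on which locint3 asks for integrability. *)
Definition core (e : R) : set (tpt R) :=
  ([set` `[e, T - e]] : set (measurableTypeR R)) `*`
  ((([set` `[0, L[]) : set (measurableTypeR R)) `*`
   ([set` `[c + e, d - e]] : set (measurableTypeR R))).

Lemma measurable_core e : measurable (core e).
Proof.
apply: measurableX; first exact: measurable_itvR.
by apply: measurableX; exact: measurable_itvR.
Qed.

Lemma core_cylinder e : 0 < e -> core e `<=` cylinder T L c d.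
Proof.
move=> e0 [t [x y]] [/= t1 [/= x1 y1]]; split => /=; last split => //=.
  move: t1; rewrite /times /= !in_itv/= => /andP[t1 t2].
  by rewrite (lt_le_trans e0)//= (le_lt_trans t2)// ltrBlDr ltrDl.
move: y1; rewrite !in_itv/= => /andP[y1 y2].
by apply/andP; split; lra.
Qed.

Lemma measurable_cylinder : measurable (cylinder T L c d).
Proof. by apply: measurableX; [exact: measurable_itvR|exact: measurable_strip]. Qed.

Lemma locint3_measurable v : locint3 T L c d v ->
  measurable_fun (cylinder T L c d) v.
Proof.
move=> iv; rewrite (_ : cylinder T L c d = \bigcup_n core n.+1%:R^-1).
  apply/measurable_fun_bigcup => n; first exact: measurable_core.
  apply/measurable_EFinP; apply: measurable_int.
  by apply: iv; rewrite invr_gt0 ltr0n.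
apply/seteqP; split=> [[t [x y]] [/= tT [/= x1 y1]]|z [n _]]; last first.
  by apply: core_cylinder; rewrite invr_gt0 ltr0n.
move: tT y1; rewrite /times /= !in_itv/= => /andP[t0 tT] /andP[cy yd].
pose e := Num.min (Num.min t (T - t)) (Num.min (y - c) (d - y)).
have e0 : 0 < e by rewrite !lt_min t0 !subr_gt0 tT cy yd.
have [n _ /(_ n (leqnn n)) /= ne] := near_infty_natSinv_lt (PosNum e0).
move: ne; rewrite !lt_min => /andP[/andP[n1 n2] /andP[n3 n4]].
exists n => //; split; last split => //=; rewrite /= in_itv/=; apply/andP.
  by move: n1 n2; set r := _^-1 => n1 n2; split; lra.
by move: n3 n4; set r := _^-1 => n3 n4; split; lra.
Qed.

Lemma bounded_test2 f : test2 L c d f ->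
  exists M, forall x : R * R, strip L c d x -> `|f x| <= M.
Proof.
move=> [Cf _ _]; have cf := smooth_continuous Cf.
have [M M0 fM] := continuous_bounded2 0 L c d cf.
exists M => -[x y] [/= x1 y1]; apply: fM.
  by move: x1; rewrite !in_itv/= => /andP[-> /ltW].
by move: y1; rewrite !in_itv/= => /andP[/ltW -> /ltW].
Qed.

(** The support of f keeps away from the boundary of the strip, which makes up
    for v being integrable only locally in x_2. *)
Lemma integrable_times_strip v f e : locint3 T L c d v -> test2 L c d f ->
  0 < e -> leb3.-integrable (([set` `[e, T - e]] : set (measurableTypeR R)) `*`
    strip L c d) (EFin \o (fun z => v z * f z.2)).
Proof.
move=> iv tf e0; have [Cf _ [r r0 fr]] := tf; have [M fM] := bounded_test2 tf.
pose e' := Num.min e r.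
have e'0 : 0 < e' by rewrite lt_min e0.
have e'e : e' <= e by rewrite ge_min lexx.
have e'r : e' <= r by rewrite ge_min lexx orbT.
pose K : set (tpt R) := ([set` `[e, T - e]] : set (measurableTypeR R)) `*`
  ((([set` `[0, L[]) : set (measurableTypeR R)) `*`
   ([set` `[c + e', d - e']] : set (measurableTypeR R))).
have mK : measurable K.
  apply: measurableX; first exact: measurable_itvR.
  by apply: measurableX; exact: measurable_itvR.
have mD : measurable (([set` `[e, T - e]] : set (measurableTypeR R)) `*` strip L c d).
  by apply: measurableX; [exact: measurable_itvR|exact: measurable_strip].
have KD : K `<=` ([set` `[e, T - e]] : set (measurableTypeR R)) `*` strip L c d.
  move=> [t [x y]] [/= t1 [/= x1 y1]]; split => //=; split => //=.
  by move: y1; rewrite !in_itv/= => /andP[y1 y2]; apply/andP; split; lra.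
apply: (integrable_support mK mD KD).
  move=> [t [x y]] [/= t1 [/= x1 y1]] nK.
  have [->|/fr/= /andP[y2 y3]] := eqVneq (f (x, y)) 0; first by rewrite mulr0.
  case: nK; split => //=; split => //=; rewrite in_itv/=.
  by apply/andP; split; lra.
apply: (@integrable_bounded_mul _ _ R leb3 K v (fun z => f z.2) M) => //.
- apply: measurable_funTS; apply: (@measurableT_comp _ _ _ _ (pt R) _ f).
    by apply: continuous_measurable2; exact: smooth_continuous.
  exact: measurable_snd.
- by move=> z /KD[_ /fM].
- apply: (integrableS _ _ _ (iv e' e'0)) => //; first exact: measurable_core.
  move=> [t [x y]] [/= t1 [/= x1 y1]]; split => //=.
  by move: t1; rewrite !in_itv/= => /andP[t1 t2]; apply/andP; split; lra.
Qed.

Lemma locint1_moment v f : locint3 T L c d v -> test2 L c d f ->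
  locint1 T (moment v f).
Proof.
move=> iv tf e e0.
exact: (integrable_slice_integral (measurable_itvR `[e, T - e])
  (measurable_strip L c d) (integrable_times_strip iv tf e0)).
Qed.

Lemma integrable_tensor v th f : locint3 T L c d v -> test1 T th ->
  test2 L c d f ->
  leb3.-integrable (cylinder T L c d) (EFin \o (fun z => v z * tensor th f z)).
Proof.
move=> iv [Ct [e e0 te]] tf.
have : compact (th @` [set` `[e, T - e]]).
  apply: continuous_compact; last exact: segment_compact.
  exact/continuous_subspaceT/smooth_continuous.
move=> /compact_bounded[M [_ HM]].
pose K : set (tpt R) := ([set` `[e, T - e]] : set (measurableTypeR R)) `*` strip L c d.
have mK : measurable K.
  by apply: measurableX; [exact: measurable_itvR|exact: measurable_strip].
have KD : K `<=` cylinder T L c d.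
  move=> [t x] [/= t1 ?]; split => //=.
  move: t1; rewrite /times /= !in_itv/= => /andP[t1 t2].
  by rewrite (lt_le_trans e0)//= (le_lt_trans t2)// ltrBlDr ltrDl.
apply: (integrable_support mK measurable_cylinder KD).
  move=> [t x] [/= _ xs] nK.
  have [h|/te te'] := eqVneq (th t) 0; first by rewrite /tensor /= h mul0r mulr0.
  by case: nK; split => //=; rewrite in_itv.
rewrite (_ : (fun z => _) = (fun z => (v z * f z.2) * th z.1)); last first.
  by apply/funext => z; rewrite /tensor mulrAC mulrA.
apply: (@integrable_bounded_mul _ _ R leb3 K _ (fun z => th z.1) (M + 1)) => //.
- apply: measurable_funTS; apply: (@measurableT_comp _ _ _ _ (measurableTypeR R) _ th).
    exact: smooth_measurable.
  exact: measurable_fst.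
- by move=> z [zI _]; apply: HM; rewrite ?ltrDl//; exists z.1.
- exact: integrable_times_strip.
Qed.

Lemma Rintegral_tensor v th f : locint3 T L c d v -> test1 T th ->
  test2 L c d f ->
  \int[leb3]_(z in cylinder T L c d) (v z * tensor th f z) =
  \int[mu]_(t in times T) (th t * moment v f t).
Proof.
move=> iv tth tf; have iz := integrable_tensor iv tth tf.
rewrite (Rintegral_rectangle (measurable_times T) (measurable_strip L c d) iz).
apply: ae_eq_Rintegral.
- exact: measurable_times.
- apply/measurable_EFinP; apply: measurable_int.
  exact: (integrable_slice_integral (measurable_times T) (measurable_strip L c d) iz).
- apply/measurable_EFinP; apply: measurable_int.
  by apply: integrable_test1 => //; exact: locint1_moment.
apply: ae_imp (ae_integrable_slice (measurable_times T) (measurable_strip L c d) iz).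
move=> t + Tt => /(_ Tt) it.
have [t0|t0] := eqVneq (th t) 0.
  rewrite t0 mul0r; under eq_Rintegral do rewrite /tensor /= t0 mul0r mulr0.
  by rewrite Rintegral_cst ?mul0r//; exact: measurable_strip.
rewrite /moment -RintegralZl.
- by apply: eq_Rintegral => x _; rewrite /tensor mulrCA.
- exact: measurable_strip.
- have := integrableZl (measurable_strip L c d) (th t)^-1 it.
  apply: eq_integrable; first exact: measurable_strip.
  by move=> x _; rewrite /tensor /= -EFinM mulrCA mulKf.
Qed.

Lemma is_wDt_time_derivative k a b v g f : is_wDt T L c d k a b v g ->
  test2 L c d f ->
  time_derivative T k (moment v (pD a b f))
    (fun t => (-1) ^+ (a + b) * moment g f t).
Proof.
move=> [iv ig E] tf; split.
- by apply: locint1_moment => //; exact: test2_pD.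
- by apply: locint1Z; exact: locint1_moment.
move=> th tth; have := E _ (test3_tensor tth tf).
have [Ct _] := tth; have [Cf _ _] := tf.
rewrite (pDt_tensor k a b Ct Cf) !Rintegral_tensor//; last 2 first.
  exact: test1_derive.
  exact: test2_pD.
move=> ->; under [in RHS]eq_Rintegral do rewrite mulrCA.
rewrite [in RHS]RintegralZl; last 2 first.
  exact: measurable_times.
  by apply: integrable_test1 => //; exact: locint1_moment.
by rewrite mulrA -exprD addnA.
Qed.

End moments.

(** * Test pairs of the weak formulation *)

Section weak_formulation_tests.
Context {R : realType}.
Variable L : R.

Definition component (i : 'I_2) (f : R * R -> R) : vfield R :=
  fun j => if j == i then f else fun=> 0.

Definition pDv (v : vfield R) (a b : nat) : vfield R := fun j => pD a b (v j).

Lemma pD_cst0 a b : pD a b (fun _ : R * R => 0 : R) = fun=> 0.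
Proof.
have it e n : iter n (fun g => 'D_(e : R * R) g) (fun _ : R * R => 0 : R) = fun=> 0.
  elim: n => [//|n IH]; rewrite iterS IH; apply/funext => x.
  exact: derive_cst.
by rewrite /pD !it.
Qed.

Lemma test2_cst0 c d : test2 L c d (fun _ : R * R => 0 : R).
Proof.
split => //; first exact: smooth_cst.
by exists 1 => // x; rewrite eqxx.
Qed.

Lemma test2_component c d i f j : test2 L c d f -> test2 L c d (component i f j).
Proof. by rewrite /component; case: ifPn => // _ _; exact: test2_cst0. Qed.

Lemma test2M c d f g : test2 L c d f -> test2 L c d g ->
  test2 L c d (fun x => f x * g x).
Proof.
move=> [Cf pf [r r0 fr]] [Cg pg _]; split; first exact: smoothM.
  by move=> x; rewrite pf pg.
by exists r => // x; rewrite mulf_eq0 negb_or => /andP[/fr].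
Qed.

Hypothesis L0 : 0 < L.

Section one_strip.
Variables (c d : R).
Hypothesis cd : c < d.

(** Integration by parts, as the integral of the derivative of f * g is 0. *)
Lemma test2_is_wD f a b : test2 L c d f -> (a + b <= 1)%N ->
  is_wD L c d a b f (pD a b f).
Proof.
move=> tf ab; have [Cf _ _] := tf.
have loc g : smooth g -> locint2 L c d g.
  move=> Cg e e0; apply: (integrableS (measurable_strip L c d)).
  - by apply: measurableX; exact: measurable_itvR.
  - move=> [x y] [/= x1 y1]; split => //=; move: y1.
    by rewrite !in_itv/= => /andP[y1 y2]; apply/andP; split; lra.
  - by apply: integrable_continuous; exact: smooth_continuous.
split; [exact: loc|by apply: loc; exact: smooth_pD|move=> g tg].
have [Cg _ _] := tg.
have iC h : smooth h -> leb2.-integrable (strip L c d) (EFin \o h).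
  by move=> Ch; apply: integrable_continuous; exact: smooth_continuous.
have parts e : 'D_e (fun x => f x * g x) =
    (fun x => f x * 'D_e g x + 'D_e f x * g x).
  apply/funext => x; rewrite -[LHS]/('D_e (f * g) x) deriveM;
    try exact: smooth_derivable.
  by congr (_ + _); rewrite mulrC.
case: a b ab => [|[|a]] [|[|b]]// _.
- by rewrite addn0 expr0 mul1r.
- have := Rintegral_derive_test2 L0 cd (test2M tf tg) (erefl (0 + 1)%N).
  rewrite -[pD 0 1 _]/('D_((0, 1) : R * R) _) parts RintegralD.
  + by move/eqP; rewrite addr_eq0 expr1 mulN1r => /eqP.
  + exact: measurable_strip.
  + by apply: iC; apply: smoothM => //; exact: smooth_derive.
  + by apply: iC; apply: smoothM => //; exact: smooth_derive.
- have := Rintegral_derive_test2 L0 cd (test2M tf tg) (erefl (1 + 0)%N).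
  rewrite -[pD 1 0 _]/('D_((1, 0) : R * R) _) parts RintegralD.
  + by move/eqP; rewrite addr_eq0 expr1 mulN1r => /eqP.
  + exact: measurable_strip.
  + by apply: iC; apply: smoothM => //; exact: smooth_derive.
  + by apply: iC; apply: smoothM => //; exact: smooth_derive.
Qed.

Lemma smooth_in_L2 (v : vfield R) : (forall j, smooth (v j)) ->
  in_L2 (strip L c d) v.
Proof.
move=> Cv; split=> [j|].
  by apply: continuous_measurable2; exact: smooth_continuous.
have fin j : (\int[leb2]_(x in strip L c d) ((v j x) ^+ 2)%:E < +oo)%E.
  have : leb2.-integrable (strip L c d) (EFin \o (fun x => v j x * v j x)).
    apply: integrable_continuous; apply: smooth_continuous.
    exact: smoothM.
  move=> /integrableP[_]; under eq_integral do rewrite /= -expr2 ger0_norm ?sqr_ge0//.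
  by [].
by rewrite /sq_L2 !big_ord_recl big_ord0 adde0 lte_add_pinfty.
Qed.

Lemma test2_in_Hk i f : test2 L c d f ->
  in_Hk L c d 1 (component i f) (pDv (component i f)).
Proof.
move=> tf; split => // a b ab; split.
  by apply: smooth_in_L2 => j; apply: smooth_pD; have [] := test2_component i j tf.
by move=> j; apply: test2_is_wD => //; exact: test2_component.
Qed.

(** The function itself serves as approximating sequence. *)
Lemma test2_zero_trace i f y : test2 L c d f -> y = c \/ y = d ->
  zero_trace L c d y (pDv (component i f)).
Proof.
move=> tf yE; split; first by move=> j; exact: measurable_cst.
exists (fun=> component i f); split.
- by move=> n j; have [? ? _] := test2_component i j tf.
- rewrite (_ : (fun n => _) = fun=> 0%E); first exact: cvg_cst.
  apply/funext => n; rewrite /sq_Hk big1// => a _; rewrite big1// => b _.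
  rewrite /sq_L2 big1// => j _; rewrite integral0_eq// => x _.
  by rewrite subrr expr0n.
- rewrite (_ : (fun n => _) = fun=> 0%E); first exact: cvg_cst.
  apply/funext => n; rewrite big1// => j _; rewrite integral0_eq// => x _.
  have [_ _ [r r0 fr]] := test2_component i j tf.
  have [->|/fr/= /andP[h1 h2]] := eqVneq (component i f j (x, y)) 0.
    by rewrite subrr expr0n.
  by exfalso; case: yE => yE; subst y; lra.
Qed.

Lemma ip_L2_component (v : vfield R) i (f : R * R -> R) :
  ip_L2 (strip L c d) v (component i f) =
  \int[leb2]_(x in strip L c d) (v i x * f x).
Proof.
rewrite /ip_L2 (bigD1 i)//= big1 => [|j ji].
  by rewrite addr0 /component eqxx.
rewrite /component (negbTE ji); under eq_Rintegral do rewrite mulr0.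
by rewrite Rintegral_cst ?mul0r//; exact: measurable_strip.
Qed.

Lemma pDv_component i f a b : pDv (component i f) a b = component i (pD a b f).
Proof.
apply/funext => j; rewrite /pDv /component; case: ifPn => // _.
exact: pD_cst0.
Qed.

(** The definition of the weak derivatives, applied to the first derivatives of
    f. *)
Lemma ip_grad_test2 (v : vfield R) D i f : in_Hk L c d 1 v D -> test2 L c d f ->
  ip_grad (strip L c d) D (pDv (component i f)) =
  - (\int[leb2]_(x in strip L c d) (v i x * pD 2 0 f x) +
     \int[leb2]_(x in strip L c d) (v i x * pD 0 2 f x)).
Proof.
move=> [_ Dv] tf; rewrite /ip_grad !pDv_component !ip_L2_component opprD.
have [_ /(_ i)[_ _ E10]] := Dv 1%N 0%N isT.
have [_ /(_ i)[_ _ E01]] := Dv 0%N 1%N isT.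
have H10 := etrans (E10 _ (test2_pD 1 0 tf)) (mulN1r _).
have H01 := etrans (E01 _ (test2_pD 0 1 tf)) (mulN1r _).
apply/esym; congr (_ + _); apply/eqP; rewrite eqr_oppLR; apply/eqP.
  exact: H10.
exact: H01.
Qed.

End one_strip.

Variables h1 h2 : R.
Hypotheses (h1_gt0 : 0 < h1) (h1_lt_h2 : h1 < h2).

Lemma test2_in_V i f g : test2 L h1 h2 f -> test2 L 0 h1 g ->
  in_V L h1 h2 (component i f) (component i g)
    (pDv (component i f)) (pDv (component i g)).
Proof.
move=> tf tg; split.
- by split; [exact: test2_in_Hk|apply: test2_zero_trace => //; right].
- by split; [exact: test2_in_Hk|apply: test2_zero_trace => //; left].
- exists (fun _ _ => 0); split; apply: test2_zero_trace => //; [by left|by right].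
Qed.

End weak_formulation_tests.

(** * The equations satisfied by the moments *)

Section weak_equations.
Context {R : realType}.
Variables T L h1 h2 : R.
Hypotheses (L0 : 0 < L) (h1_gt0 : 0 < h1) (h1_lt_h2 : h1 < h2).
Local Notation mu := (@lebesgue_measure R).
Variables (u w z : tvfield R).

Lemma time_derivative_comp j k m m1 m2 : time_derivative T j m m1 ->
  time_derivative T k m1 m2 -> time_derivative T (j + k) m m2.
Proof.
move=> [i0 i1 E1] [_ i2 E2]; split => // th tth.
by rewrite iterD (E1 _ (test1_derive k tth)) E2// mulrA -exprD.
Qed.

(** Both equations are read off from the pair with components f and g: the
    boundary terms vanish and the Laplacian falls on the test functions, so the
    pairing with the dual-valued time derivative equals m at almost every time. *)
Lemma weak_moments Du Dw F i f g (m := fun t : R =>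
    moment L h1 h2 (u i) (pD 2 0 f) t + moment L h1 h2 (u i) (pD 0 2 f) t
    + (moment L 0 h1 (w i) (pD 2 0 g) t + moment L 0 h1 (w i) (pD 0 2 g) t
      + -1 * moment L 0 h1 (w i) g t)) :
  (forall i, locint3 T L h1 h2 (u i)) -> (forall i, locint3 T L 0 h1 (w i)) ->
  (forall i, locint3 T L 0 h1 (z i)) ->
  Hk_valued T L h1 h2 1 u Du -> Hk_valued T L 0 h1 1 w Dw ->
  is_dt T L h1 h2 u z F ->
  (forall pf ps Df Ds, in_V L h1 h2 pf ps Df Ds ->
    {ae leb1, forall t : measurableTypeR R, times T t ->
       F t pf ps
       + ip_grad (strip L h1 h2) (fun a b => slice (Du a b) t) Df
       + ip_grad (strip L 0 h1) (fun a b => slice (Dw a b) t) Ds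
       + ip_L2 (strip L 0 h1) (slice w t) ps = 0}) ->
  test2 L h1 h2 f -> test2 L 0 h1 g ->
  time_derivative T 1
    (fun t => moment L h1 h2 (u i) f t + moment L 0 h1 (z i) g t) m.
Proof.
have alg (x p q r q' e : R) : x + - (p + q) + - (r + q') + e = 0 ->
    x = p + q + (r + q' + -1 * e) by move=> ?; lra.
move=> iu iw iz [_ _ Hu] [_ _ Hw] [_ mF _ _ EF] eqF tf tg.
have V := test2_in_V L0 h1_gt0 h1_lt_h2 i tf tg.
have im : locint1 T m.
  have lf a b := locint1_moment (iu i) (test2_pD a b tf).
  have lg a b := locint1_moment (iw i) (test2_pD a b tg).
  exact: (locint1D (locint1D (lf 2 0) (lf 0 2))
    (locint1D (locint1D (lg 2 0) (lg 0 2)) (locint1Z (-1) (lg 0 0))))%N.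
have iM := locint1D (locint1_moment (iu i) tf)
  (locint1_moment (iz i) tg).
split; [exact: iM|exact: im|].
move=> th tth; have := EF _ _ _ _ _ V tth.
under eq_Rintegral do rewrite derive1E !ip_L2_component.
move=> ->; rewrite expr1 mulN1r; congr (- _).
have mth : measurable_fun (times T) th.
  by apply: smooth_measurable; have [] := tth.
apply: ae_eq_Rintegral.
- exact: measurable_times.
- by apply: measurable_funM => //; exact: mF V.
- apply/measurable_EFinP; apply: measurable_int.
  exact: (integrable_test1 tth im).
have := ae_imp2 _ Hu Hw; move=> /(_ (fun t => times T t ->
  in_Hk L h1 h2 1 (slice u t) (fun a b => slice (Du a b) t) /\
  in_Hk L 0 h1 1 (slice w t) (fun a b => slice (Dw a b) t))).
move=> /(_ (fun t H1 H2 Tt => conj (H1 Tt) (H2 Tt))).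
move=> /(ae_imp2 _ (eqF _ _ _ _ V)); apply => t + + Tt.
move=> /(_ Tt) E /(_ Tt)[Hut Hwt]; congr (_ * _).
move: E; rewrite (ip_grad_test2 i Hut tf) (ip_grad_test2 i Hwt tg).
rewrite ip_L2_component => E.
exact: (alg _ _ _ _ _ _ E).
Qed.

Lemma moment0 c d (v : R * (R * R) -> R) t : moment L c d v (fun=> 0) t = 0.
Proof.
rewrite /moment; under eq_Rintegral do rewrite mulr0.
by rewrite Rintegral_cst ?mul0r//; exact: measurable_strip.
Qed.

Hypothesis sol : weak_solution T L h1 h2 u w z.
Hypothesis iu : forall i, locint3 T L h1 h2 (u i).

Let iw i : locint3 T L 0 h1 (w i).
Proof. by case: sol => _ _ /(_ i)[]. Qed.

Let iz i : locint3 T L 0 h1 (z i).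
Proof. by case: sol => _ _ /(_ i)[]. Qed.

(** The pair (f, 0). *)
Lemma heat_moments i f : test2 L h1 h2 f ->
  time_derivative T 1 (moment L h1 h2 (u i) f)
    (fun t => moment L h1 h2 (u i) (pD 2 0 f) t
      + moment L h1 h2 (u i) (pD 0 2 f) t).
Proof.
move=> tf; have [_ _ _ [Du [Dw [F [[Hu _] [Hw _] _ HF eqF]]]]] := sol.
have := weak_moments i iu iw iz Hu Hw HF eqF tf (test2_cst0 L 0 h1).
rewrite !pD_cst0 (_ : (fun t => _) = moment L h1 h2 (u i) f); last first.
  by apply/funext => t; rewrite moment0 addr0.
rewrite (_ : (fun t => _ + _ + _) = (fun t => moment L h1 h2 (u i) (pD 2 0 f) t
      + moment L h1 h2 (u i) (pD 0 2 f) t))//.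
by apply/funext => t; rewrite !moment0 mulr0 !addr0.
Qed.

(** The pair (0, g); the first time derivative of the moment of w is that of
    z. *)
Lemma wave_moments i g : test2 L 0 h1 g ->
  time_derivative T 2 (moment L 0 h1 (w i) g)
    (fun t => moment L 0 h1 (w i) (pD 2 0 g) t
      + moment L 0 h1 (w i) (pD 0 2 g) t + -1 * moment L 0 h1 (w i) g t).
Proof.
move=> tg; have [_ _ /(_ i) wz [Du [Dw [F [[Hu _] [Hw _] _ HF eqF]]]]] := sol.
have := weak_moments i iu iw iz Hu Hw HF eqF (test2_cst0 L h1 h2) tg.
rewrite !pD_cst0 (_ : (fun t => _) = moment L 0 h1 (z i) g); last first.
  by apply/funext => t; rewrite moment0 add0r.
have E := is_wDt_time_derivative wz tg.
rewrite (_ : (fun t => _ * _) = moment L 0 h1 (z i) g) in E; last first.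
  by apply/funext => t; rewrite expr0 mul1r.
move=> H; have := time_derivative_comp E H.
rewrite (_ : (fun t => _ + _ + (_ + _)) =
    (fun t => moment L 0 h1 (w i) (pD 2 0 g) t
      + moment L 0 h1 (w i) (pD 0 2 g) t + -1 * moment L 0 h1 (w i) g t))//.
by apply/funext => t; rewrite !moment0 !add0r.
Qed.

End weak_equations.

(** * Separability of families of continuous functions *)

Section separability.
Context {R : realType}.
Variables (L c d : R).
Variables (I : Type) (F G : I -> R * R -> R).
Hypotheses (cF : forall i, continuous (F i)) (cG : forall i, continuous (G i)).

Definition node (N : nat) (p : nat * nat) : R * R :=
  (p.1%:R / N.+1%:R, c + p.2%:R / N.+1%:R).

Definition cell (N : nat) (x : R * R) : nat * nat :=
  (Num.truncn (x.1 * N.+1%:R), Num.truncn ((x.2 - c) * N.+1%:R)).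

Definition grid (N : nat) : seq (nat * nat) :=
  [seq (a, b) | a <- iota 0 (Num.truncn (L * N.+1%:R)).+1,
                b <- iota 0 (Num.truncn ((d - c) * N.+1%:R)).+1].

Lemma cell_grid N x : strip L c d x -> cell N x \in grid N.
Proof.
move=> [/= x1 x2]; move: x1 x2; rewrite !in_itv/= => /andP[x0 xL] /andP[xc xd].
have N0 : 0 < N.+1%:R :> R by rewrite ltr0n.
apply/allpairsP; exists (cell N x); split => //; rewrite mem_iota/= add0n ltnS.
  by apply: le_truncn; rewrite ler_pM2r// ltW.
by apply: le_truncn; rewrite ler_pM2r// lerB// ltW.
Qed.

Lemma node_cell N x : strip L c d x ->
  `|x.1 - (node N (cell N x)).1| < N.+1%:R^-1 /\
  `|x.2 - (node N (cell N x)).2| < N.+1%:R^-1.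
Proof.
move=> [/= x1 x2]; move: x1 x2; rewrite !in_itv/= => /andP[x0 xL] /andP[xc xd].
have N0 : 0 < N.+1%:R :> R by rewrite ltr0n.
have tr (y : R) : 0 <= y ->
    `|y - (Num.truncn (y * N.+1%:R))%:R / N.+1%:R| < N.+1%:R^-1.
  move=> y0; have /truncn_itv/andP[t1 t2] : 0 <= y * N.+1%:R.
    by rewrite mulr_ge0// ltW.
  rewrite ger0_norm ?subr_ge0 ?ler_pdivrMr// ltrBlDr -[X in X + _]mul1r -mulrDl.
  by rewrite ltr_pdivlMr// addrC natr1.
split; first exact: tr.
by rewrite /= opprD addrA; apply: tr; rewrite subr_ge0 ltW.
Qed.

Definition grid_close (N k : nat) (i : I) : Prop := forall x, strip L c d x ->
  `|F i x - F i (node N (cell N x))| <= k.+1%:R^-1 /\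
  `|G i x - G i (node N (cell N x))| <= k.+1%:R^-1.

Definition grid_values (N k : nat) (i : I) : seq (int * int) :=
  [seq (Num.floor (k.+1%:R * F i (node N p)), Num.floor (k.+1%:R * G i (node N p)))
     | p <- grid N].

Lemma grid_close_ex k i : exists N, grid_close N k i.
Proof.
have k0 : 0 < k.+1%:R^-1 :> R by rewrite invr_gt0 ltr0n.
have [r1 r10 H1] := unif_continuous2 0 L c d (@cF i) k0.
have [r2 r20 H2] := unif_continuous2 0 L c d (@cG i) k0.
have r0 : 0 < Num.min r1 r2 by rewrite lt_min r10.
have [N _ /(_ N (leqnn N)) /=] := near_infty_natSinv_lt (PosNum r0).
rewrite lt_min => /andP[N1 N2]; exists N => x xs.
have [d1 d2] := node_cell N xs.
have x1 : x.1 \in `[0, L].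
  by case: xs => + _; rewrite /= !in_itv/= => /andP[-> /ltW].
have x2 : x.2 \in `[c, d].
  by case: xs => _; rewrite /= !in_itv/= => /andP[/ltW -> /ltW].
split; apply: ltW; [apply: H1|apply: H2] => //.
- exact: lt_trans N1.
- exact: lt_trans N1.
- exact: lt_trans N2.
- exact: lt_trans N2.
Qed.

Lemma floor_close k (x y : R) :
  Num.floor (k.+1%:R * x) = Num.floor (k.+1%:R * y) -> `|x - y| <= k.+1%:R^-1.
Proof.
move=> E; have k0 : 0 < k.+1%:R :> R by rewrite ltr0n.
have := floor_itv (k.+1%:R * x); have := floor_itv (k.+1%:R * y); rewrite E.
rewrite intrD => /andP[y1 y2] /andP[x1 x2].
rewrite -(ler_pM2l k0) mulfV ?gt_eqF// -[X in X * `|_|]gtr0_norm//.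
rewrite -normrM mulrBr ler_norml; apply/andP; split; lra.
Qed.

(** Comparing at x, at the grid point of the cell of x for i, the same for j,
    and at x again costs three errors. *)
Lemma grid_values_close N k i j x : strip L c d x ->
  grid_close N k i -> grid_close N k j -> grid_values N k i = grid_values N k j ->
  `|F i x - F j x| <= 3 * k.+1%:R^-1 /\ `|G i x - G j x| <= 3 * k.+1%:R^-1.
Proof.
move=> xs gi gj /eq_in_map /(_ _ (cell_grid N xs)) [/floor_close E1 /floor_close E2].
have [Fi Gi] := gi x xs; have [Fj Gj] := gj x xs.
have tri (a b a' b' e : R) : `|a - a'| <= e -> `|b - b'| <= e ->
    `|a' - b'| <= e -> `|a - b| <= 3 * e.
  rewrite !ler_norml => /andP[? ?] /andP[? ?] /andP[? ?].
  by apply/andP; split; lra.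
by split; [exact: tri Fi Fj E1|exact: tri Gi Gj E2].
Qed.

(** Rounding the values on a grid to multiples of 1 / (k + 1) leaves countably
    many possibilities; one index is selected for each of them. *)
Lemma dense_sequence : exists s : nat -> option I,
  forall i e, 0 < e -> exists n j, s n = Some j /\ forall x, strip L c d x ->
    `|F i x - F j x| <= e /\ `|G i x - G j x| <= e.
Proof.
pose P (q : nat * nat * seq (int * int)) i :=
  grid_close q.1.1 q.1.2 i /\ grid_values q.1.1 q.1.2 i = q.2.
pose pick (q : nat * nat * seq (int * int)) : option I :=
  match pselect (exists i, P q i) with
  | left H => Some (projT1 (cid H))
  | right _ => None
  end.
exists (fun n => obind pick (unpickle n)) => i e e0.
have e30 : 0 < e / 3 by rewrite divr_gt0.
have [k _ /(_ k (leqnn k)) /= ke] := near_infty_natSinv_lt (PosNum e30).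
have [N gN] := grid_close_ex k i.
exists (pickle (N, k, grid_values N k i)); rewrite pickleK /= /pick.
case: pselect => [H|]; last by case; exists i.
exists (projT1 (cid H)); split => // x xs.
case: (cid H) => j /= [gj Ej].
have [h1 h2] := grid_values_close xs gN gj (esym Ej).
have e3 : 3 * k.+1%:R^-1 <= e.
  by move: ke; set r := _^-1 => ke; have ke' : r < e / 3 := ke; lra.
by split; [exact: le_trans h1 e3|exact: le_trans h2 e3].
Qed.

End separability.

Section exchange.
Context {R : realType}.
Variables (T L c d : R).
Local Notation mu := (@lebesgue_measure R).

Lemma moment_close (v : R * (R * R) -> R) (f f' : R * R -> R) (t e : R) :
  leb2.-integrable (strip L c d) (fun x => (v (t, x))%:E) ->
  continuous f -> continuous f' ->
  (forall x, strip L c d x -> `|f x - f' x| <= e) ->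
  `|moment L c d v f t - moment L c d v f' t| <=
     e * \int[leb2]_(x in strip L c d) `|v (t, x)|.
Proof.
move=> iv cf cf' fe; have mS := measurable_strip L c d.
have im g : continuous g ->
    leb2.-integrable (strip L c d) (EFin \o (fun x => v (t, x) * g x)).
  move=> cg; have [M _ gM] := continuous_bounded2 0 L c d cg.
  apply: (@integrable_bounded_mul _ _ R leb2 _ (fun x => v (t, x)) g M) => //.
    exact: continuous_measurable2.
  move=> [x y] [/= x1 y1]; apply: gM.
    by move: x1; rewrite !in_itv/= => /andP[-> /ltW].
  by move: y1; rewrite !in_itv/= => /andP[/ltW -> /ltW].
have ia : leb2.-integrable (strip L c d) (EFin \o (fun x => `|v (t, x)|)).
  exact: (integrable_abse iv).
rewrite /moment -RintegralB//; try exact: im.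
have iB := integrableB mS (im _ cf) (im _ cf').
rewrite (le_trans (le_normr_Rintegral mS iB))//.
rewrite -RintegralZl//; apply: le_Rintegral => //.
- exact: (integrable_abse iB).
- exact: (integrableZl mS e ia).
- move=> x xs; rewrite -mulrBr normrM mulrC ler_wpM2r//; exact: fe.
Qed.

(** Both sides are continuous for uniform convergence of (F i, G i), so that it
    is enough to consider a dense sequence of indices. *)
Lemma ae_forall_moment (I : Type) (F G : I -> R * R -> R)
    (v g : R * (R * R) -> R) :
  (forall i, continuous (F i)) -> (forall i, continuous (G i)) ->
  {ae mu, forall t : measurableTypeR R, times T t ->
    leb2.-integrable (strip L c d) (fun x => (v (t, x))%:E)} ->
  {ae mu, forall t : measurableTypeR R, times T t ->
    leb2.-integrable (strip L c d) (fun x => (g (t, x))%:E)} ->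
  (forall i, {ae mu, forall t : measurableTypeR R, times T t ->
    moment L c d v (F i) t = moment L c d g (G i) t}) ->
  {ae mu, forall t : measurableTypeR R, times T t ->
    forall i, moment L c d v (F i) t = moment L c d g (G i) t}.
Proof.
move=> cF cG iv ig H; have [s sP] := dense_sequence L c d cF cG.
have : {ae mu, forall t : measurableTypeR R, forall n, times T t ->
    if s n is Some j then moment L c d v (F j) t = moment L c d g (G j) t
    else True}.
  apply/ae_foralln => n; case: (s n) => [j|]; first exact: H.
  exact: aeW.
move=> Hs; apply: (ae_imp2 _ iv (ae_imp2 _ ig Hs)) => t; last first.
  by move=> A B; exact: (conj A B).
move=> + [+ +] Tt i => /(_ Tt) ivt /(_ Tt) igt Ht.
apply/eqP; rewrite -subr_eq0 -normr_le0; apply/ler_addgt0Pr => e e0.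
rewrite add0r.
set A := \int[leb2]_(x in strip L c d) `|v (t, x)|.
set B := \int[leb2]_(x in strip L c d) `|g (t, x)|.
have A0 : 0 <= A by apply: Rintegral_ge0.
have B0 : 0 <= B by apply: Rintegral_ge0.
have AB : 0 < A + B + 1 by rewrite ltr_wpDl// addr_ge0.
have [n [j [sn close]]] := sP i _ (divr_gt0 e0 AB).
have := Ht n Tt; rewrite sn => Ej.
have hv := moment_close ivt (@cF i) (@cF j) (fun x xs => (close x xs).1).
have hg := moment_close igt (@cG i) (@cG j) (fun x xs => (close x xs).2).
rewrite (_ : _ - _ = (moment L c d v (F i) t - moment L c d v (F j) t)
  - (moment L c d g (G i) t - moment L c d g (G j) t)); last first.
  by rewrite Ej opprB addrA subrK.
rewrite (le_trans (ler_normB _ _))// (le_trans (lerD hv hg))//.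
rewrite -mulrDr mulrAC ler_pdivrMr// ler_pM2l// -/A -/B lerDl.
exact: ler01.
Qed.

End exchange.

(** * Derivatives in space at almost every time *)

Section slices.
Context {R : realType}.
Variables (T L c d : R).
Local Notation mu := (@lebesgue_measure R).

Lemma ae_forall_ord n (P : 'I_n -> measurableTypeR R -> Prop) :
  (forall i, {ae mu, forall t : measurableTypeR R, P i t}) ->
  {ae mu, forall t : measurableTypeR R, forall i, P i t}.
Proof. exact: filter_forall. Qed.

(** The strip has finite measure, so that |v| <= 1 + v ^ 2 suffices. *)
Lemma in_L2_integrable (v : vfield R) i : in_L2 (strip L c d) v ->
  leb2.-integrable (strip L c d) (EFin \o v i).
Proof.
move=> [mv sv]; have mS := measurable_strip L c d.
have sq : leb2.-integrable (strip L c d) (EFin \o (fun x => (v i x) ^+ 2)).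
  apply/integrableP; split.
    by apply/measurable_EFinP; exact: measurable_funX.
  under eq_integral do rewrite /= ger0_norm ?sqr_ge0//.
  apply: le_lt_trans sv; rewrite /sq_L2 (bigD1 i)//= leeDl// sume_ge0// => j _.
  by apply: integral_ge0 => x _; rewrite lee_fin sqr_ge0.
have one : leb2.-integrable (strip L c d) (EFin \o (fun=> 1)).
  by apply: integrable_continuous => x; exact: cst_continuous.
apply: (le_integrable mS _ _ (integrableD mS one sq)).
  exact/measurable_EFinP.
move=> x xS; rewrite /= lee_fin [leRHS]ger0_norm; last by rewrite addr_ge0// sqr_ge0.
have := sqr_ge0 (`|v i x| - 1); rewrite -(real_normK (num_real (v i x))).
have := normr_ge0 (v i x); set y := `|_| => y0; rewrite sqrrB1 => h.
have := sqr_ge0 y; lra.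
Qed.

Lemma integrable_locint2 (v : R * R -> R) :
  leb2.-integrable (strip L c d) (EFin \o v) -> locint2 L c d v.
Proof.
move=> iv e e0; apply: (integrableS (measurable_strip L c d)) iv.
- by apply: measurableX; exact: measurable_itvR.
- move=> [x y] [/= x1 y1]; split => //=; move: y1.
  by rewrite !in_itv/= => /andP[y1 y2]; apply/andP; split; lra.
Qed.

Lemma integrable_mul_smooth (v f : R * R -> R) : smooth f ->
  leb2.-integrable (strip L c d) (EFin \o v) ->
  leb2.-integrable (strip L c d) (EFin \o (fun x => v x * f x)).
Proof.
move=> Cf iv; have cf := smooth_continuous Cf.
have [M _ fM] := continuous_bounded2 0 L c d cf.
apply: (@integrable_bounded_mul _ _ R leb2 _ v f M) => //.
- exact: measurable_strip.
- exact: continuous_measurable2.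
- move=> [x y] [/= x1 y1]; apply: fM.
    by move: x1; rewrite !in_itv/= => /andP[-> /ltW].
  by move: y1; rewrite !in_itv/= => /andP[/ltW -> /ltW].
Qed.

Lemma is_wDt_time_derivative0 k (w v : R * (R * R) -> R) f :
  is_wDt T L c d k 0 0 w v -> test2 L c d f ->
  time_derivative T k (moment L c d w f) (moment L c d v f).
Proof.
move=> wv tf; have := is_wDt_time_derivative wv tf.
rewrite (_ : (fun t => _ * _) = moment L c d v f)//.
by apply/funext => t; rewrite expr0 mul1r.
Qed.

(** For each test function the moments of v and g are both the k-th time
    derivative of the same moment of w, hence they agree almost everywhere; the
    null set is then made independent of the test function. *)
Lemma ae_is_wD k a b (w v g : R * (R * R) -> R) :
  is_wDt T L c d k 0 0 w v -> is_wDt T L c d k a b w g ->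
  {ae mu, forall t : measurableTypeR R, times T t ->
    leb2.-integrable (strip L c d) (fun x => (v (t, x))%:E)} ->
  {ae mu, forall t : measurableTypeR R, times T t ->
    leb2.-integrable (strip L c d) (fun x => (g (t, x))%:E)} ->
  {ae mu, forall t : measurableTypeR R, times T t ->
    is_wD L c d a b (fun x => v (t, x)) (fun x => g (t, x))}.
Proof.
move=> wv wg iv ig; have mS := measurable_strip L c d.
pose I := {f : R * R -> R | test2 L c d f}.
pose F (i : I) := pD a b (projT1 i).
pose G (i : I) : R * R -> R := fun x => (-1) ^+ (a + b) * projT1 i x.
have CF i : smooth (F i).
  by apply: smooth_pD; have [] := projT2 i.
have CG i : smooth (G i).
  by apply: smoothM; [exact: smooth_cst|have [] := projT2 i].
have GE i t : leb2.-integrable (strip L c d) (fun x => (g (t, x))%:E) ->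
    moment L c d g (G i) t = (-1) ^+ (a + b) * moment L c d g (projT1 i) t.
  move=> igt; rewrite /moment -RintegralZl//.
    by apply: eq_Rintegral => x _; rewrite /G mulrCA.
  by apply: integrable_mul_smooth => //; have [] := projT2 i.
have H i : {ae mu, forall t : measurableTypeR R, times T t ->
    moment L c d v (F i) t = moment L c d g (G i) t}.
  have ti := projT2 i.
  have A := is_wDt_time_derivative0 wv (test2_pD a b ti).
  have B := is_wDt_time_derivative wg ti.
  apply: (ae_imp2 _ ig (time_derivative_unique A B)) => t igt E Tt.
  by rewrite GE; [exact: E|exact: igt].
have := ae_forall_moment (fun i => smooth_continuous (CF i))
  (fun i => smooth_continuous (CG i)) iv ig H.
apply: ae_imp2 (ae_imp2 (fun t A B => conj A B) iv ig) => t [ivt igt] E Tt.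
split; [exact/integrable_locint2/ivt|exact/integrable_locint2/igt|move=> f tf].
by rewrite -[LHS]/(moment L c d v (F (exist _ f tf)) t) E// GE//; exact: igt.
Qed.

(** Both derivatives stay on the test function: that the second derivative of v
    in x_2 is a function is a consequence, not part of the notion. *)
Definition weak_laplacian (v f : R * R -> R) : Prop :=
  forall h, test2 L c d h ->
    \int[leb2]_(x in strip L c d) (v x * (pD 2 0 h x + pD 0 2 h x)) =
    \int[leb2]_(x in strip L c d) (f x * h x).

Lemma ae_weak_laplacian (v f : R * (R * R) -> R) :
  {ae mu, forall t : measurableTypeR R, times T t ->
    leb2.-integrable (strip L c d) (fun x => (v (t, x))%:E)} ->
  {ae mu, forall t : measurableTypeR R, times T t ->
    leb2.-integrable (strip L c d) (fun x => (f (t, x))%:E)} ->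
  (forall h, test2 L c d h -> {ae mu, forall t : measurableTypeR R, times T t ->
    moment L c d v (pD 2 0 h) t + moment L c d v (pD 0 2 h) t
    = moment L c d f h t}) ->
  {ae mu, forall t : measurableTypeR R, times T t ->
    weak_laplacian (fun x => v (t, x)) (fun x => f (t, x))}.
Proof.
move=> iv iF H.
pose I := {h : R * R -> R | test2 L c d h}.
pose F (i : I) : R * R -> R := fun x => pD 2 0 (projT1 i) x + pD 0 2 (projT1 i) x.
have C i : smooth (projT1 (i : I)) by have [] := projT2 i.
have CF i : smooth (F i) by apply: smoothD; exact: smooth_pD.
have E i : {ae mu, forall t : measurableTypeR R, times T t ->
    moment L c d v (F i) t = moment L c d f (projT1 i) t}.
  apply: (ae_imp2 _ iv (H _ (projT2 i))) => t ivt hE Tt.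
  rewrite -(hE Tt) /moment -RintegralD; try exact: measurable_strip;
    try by apply: integrable_mul_smooth; [exact: smooth_pD|exact: ivt Tt].
  by apply: eq_Rintegral => x _; rewrite mulrDr.
have := ae_forall_moment (fun i => smooth_continuous (CF i))
  (fun i => smooth_continuous (C i)) iv iF E.
apply: ae_imp => t Ht Tt h th; exact: (Ht Tt (exist _ h th)).
Qed.

(** The equation is tested with pD a b h, and the two derivatives in x_2 are
    recognized as part of pD a b.+2 h. *)
Lemma weak_laplacian_is_wD (v f V F : R * R -> R) a b :
  weak_laplacian v f -> is_wD L c d a b f F -> is_wD L c d a.+2 b v V ->
  leb2.-integrable (strip L c d) (EFin \o v) ->
  leb2.-integrable (strip L c d) (EFin \o F) ->
  leb2.-integrable (strip L c d) (EFin \o V) ->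
  is_wD L c d a b.+2 v (fun x => F x - V x).
Proof.
move=> vf [_ _ fF] [_ _ vV] iv iF iV; have mS := measurable_strip L c d.
split; [exact: integrable_locint2| |move=> h th].
  apply: integrable_locint2; have := integrableB mS iF iV.
  by apply: eq_integrable => // x _; rewrite /= EFinB.
have [Ch _ _] := th; have tp := test2_pD a b th; have [Cp _ _] := tp.
have E2 : \int[leb2]_(x in strip L c d) (v x * pD 2 0 (pD a b h) x) =
    (-1) ^+ (a.+2 + b) * \int[leb2]_(x in strip L c d) (V x * h x) := vV _ th.
have iv2 := integrable_mul_smooth (smooth_pD 2 0 Cp) iv.
have iv0 := integrable_mul_smooth (smooth_pD 0 2 Cp) iv.
have EB : \int[leb2]_(x in strip L c d) ((F x - V x) * h x) =
    \int[leb2]_(x in strip L c d) (F x * h x) -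
    \int[leb2]_(x in strip L c d) (V x * h x).
  under eq_Rintegral do rewrite mulrBl.
  rewrite (RintegralB mS (integrable_mul_smooth Ch iF)) //.
  exact: (integrable_mul_smooth Ch iV).
have ED : \int[leb2]_(x in strip L c d)
      (v x * (pD 2 0 (pD a b h) x + pD 0 2 (pD a b h) x)) =
    \int[leb2]_(x in strip L c d) (v x * pD 2 0 (pD a b h) x) +
    \int[leb2]_(x in strip L c d) (v x * pD a b.+2 h x).
  under eq_Rintegral do rewrite mulrDr.
  by rewrite (pD_add2 a b Ch); exact: (RintegralD mS iv2 iv0).
have E3 := etrans (esym ED) (etrans (vf _ tp) (fF _ th)).
have alg (s X Y Z W : R) : X + Y = s * Z -> X = s * W -> Y = s * (Z - W).
  by move=> XY XW; rewrite mulrBr -XY -XW addrAC subrr add0r.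
have s2 : (-1) ^+ (a.+2 + b) = (-1) ^+ (a + b) :> R.
  by rewrite !addSn !exprS !mulN1r opprK.
have s2' : (-1) ^+ (a + b.+2) = (-1) ^+ (a + b) :> R.
  by rewrite !addnS !exprS !mulN1r opprK.
rewrite s2' EB; rewrite s2 in E2; exact: alg E3 E2.
Qed.

End slices.

(** * Bounds in time *)

Section time_norms.
Context {R : realType}.
Variables (T L c d : R).
Local Notation mu := (@lebesgue_measure R).
Implicit Types (f g h : tvfield R).

Definition field_measurable g : Prop :=
  forall i, measurable_fun (cylinder T L c d) (g i).

Definition sqn g (t : R) : \bar R := sq_L2 (strip L c d) (slice g t).

Lemma sqn_ge0 g t : (0 <= sqn g t)%E.
Proof.
apply: sume_ge0 => i _; apply: integral_ge0 => x _.
by rewrite lee_fin sqr_ge0.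
Qed.

Let mC := measurable_cylinder T L c d.
Let mS := measurable_strip L c d.

Lemma measurable_slice g i t : field_measurable g -> times T t ->
  measurable_fun (strip L c d) (slice g t i).
Proof.
move=> /(_ i)/(measurable_restrictT _ mC).1 mg Tt.
have E : slice g t i \_ (strip L c d) = (g i \_ (cylinder T L c d)) \o pair t.
  apply/funext => x; rewrite /= !patchE /slice.
  have [xS|xS] := boolP (x \in strip L c d).
    by rewrite mem_set//; split => //=; exact: set_mem xS.
  by rewrite memNset// => -[_ /= xS']; move: xS; rewrite mem_set.
have M : measurable_fun setT (slice g t i \_ (strip L c d)).
  by rewrite E; apply: measurableT_comp => //; exact: pair1_measurable.
exact: ((measurable_restrictT _ mS).2 M).
Qed.

(** Tonelli's theorem, applied to the extension by 0 of the square. *)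
Lemma measurable_sqn g : field_measurable g -> measurable_fun (times T) (sqn g).
Proof.
move=> mg; apply: emeasurable_sum => i.
pose k := (fun z => ((g i z) ^+ 2)%:E) \_ (cylinder T L c d).
have mk : measurable_fun setT k.
  have mq : measurable_fun (cylinder T L c d) (fun z => ((g i z) ^+ 2)%:E).
    by apply/measurable_EFinP; apply: measurable_funX; exact: mg.
  exact: ((measurable_restrictT _ mC).1 mq).
have k0 z : (0 <= k z)%E.
  by rewrite /k patchE; case: ifPn => // _; rewrite lee_fin sqr_ge0.
apply: (@eq_measurable_fun _ _ _ _ _ (fun t => \int[leb2]_x k (t, x))%E).
  move=> t /set_mem Tt; rewrite [RHS]integral_mkcond; apply: eq_integral => x _.
  rewrite /k !patchE /slice; have [xS|xS] := boolP (x \in strip L c d).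
    by rewrite mem_set//; split => //=; exact: set_mem xS.
  by rewrite memNset// => -[_ /= xS']; move: xS; rewrite mem_set.
apply: measurable_funTS.
exact: (@measurable_fun_fubini_tonelli_F _ _ _ _ _ leb2 k mk k0).
Qed.

Lemma sqn_in_L2 g t : field_measurable g -> times T t -> (sqn g t < +oo)%E ->
  in_L2 (strip L c d) (slice g t).
Proof. by move=> mg Tt gt; split => // i; exact: measurable_slice. Qed.

(** Covers sums and differences, both through
    (x + y) ^ 2 <= 2 x ^ 2 + 2 y ^ 2. *)
Lemma le_sqn f g h t : field_measurable f -> field_measurable g ->
  field_measurable h -> times T t ->
  (forall i z, h i z ^+ 2 <= f i z ^+ 2 + f i z ^+ 2 + (g i z ^+ 2 + g i z ^+ 2)) ->
  (sqn h t <= sqn f t + sqn f t + (sqn g t + sqn g t))%E.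
Proof.
move=> mf mg mh Tt hfg; rewrite /sqn /sq_L2 -!big_split/=; apply: lee_sum => i _.
have mE k : field_measurable k ->
    measurable_fun (strip L c d) (fun x => (slice k t i x ^+ 2)%:E).
  move=> mk; apply/measurable_EFinP; apply: measurable_funX.
  exact: measurable_slice.
have sq0 k x : (0 <= (slice k t i x ^+ 2)%:E)%E by rewrite lee_fin sqr_ge0.
rewrite -!ge0_integralD//; try (exact: mE); last 4 first.
- by move=> x _; rewrite adde_ge0.
- by apply: emeasurable_funD; exact: mE.
- by move=> x _; rewrite adde_ge0.
- by apply: emeasurable_funD; exact: mE.
apply: ge0_le_integral => //; first exact: mE.
  by apply: emeasurable_funD; apply: emeasurable_funD; exact: mE.
by move=> x _; rewrite -!EFinD lee_fin; exact: hfg.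
Qed.

Definition Linf_size (k : R -> \bar R) : Prop :=
  exists M : R, {ae mu, forall t : measurableTypeR R, times T t -> (k t <= M%:E)%E}.

Definition L1_size (k : R -> \bar R) : Prop :=
  (\int[mu]_(t in times T) k t < +oo)%E.

Definition admissible (k : R -> \bar R) : Prop :=
  measurable_fun (times T) k /\ forall t, (0 <= k t)%E.

(** What the boundedness in time of a nonnegative quantity has to satisfy for
    the argument; the instances are L^oo and L^1 bounds on squares of norms. *)
Record size_class (B : (R -> \bar R) -> Prop) : Prop := SizeClass {
  size0 : B (fun=> 0%E);
  sizeD : forall k1 k2, admissible k1 -> admissible k2 -> B k1 -> B k2 ->
    B (fun t => k1 t + k2 t)%E;
  size_le : forall k1 k2, admissible k1 -> admissible k2 ->
    {ae mu, forall t : measurableTypeR R, times T t -> (k1 t <= k2 t)%E} ->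
    B k2 -> B k1;
  size_fin : forall k, admissible k -> B k ->
    {ae mu, forall t : measurableTypeR R, times T t -> (k t < +oo)%E} }.

Lemma Linf_size_class : size_class Linf_size.
Proof.
split.
- by exists 0; apply: aeW.
- move=> k1 k2 _ _ [M1 H1] [M2 H2]; exists (M1 + M2).
  by apply: ae_imp2 H1 H2 => t h1 h2 Tt; rewrite EFinD leeD// ?h1 ?h2.
- move=> k1 k2 _ _ k12 [M H]; exists M.
  by apply: ae_imp2 k12 H => t h1 h2 Tt; exact: le_trans (h1 Tt) (h2 Tt).
- move=> k _ [M H]; apply: ae_imp H => t h Tt.
  by rewrite (le_lt_trans (h Tt))// ltry.
Qed.

Lemma L1_size_class : size_class L1_size.
Proof.
have mT := measurable_times T; split.
- by rewrite /L1_size integral0.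
- move=> k1 k2 [m1 p1] [m2 p2] i1 i2; rewrite /L1_size ge0_integralD//.
  by rewrite lte_add_pinfty.
- move=> k1 k2 [m1 p1] [m2 p2] k12 i2; apply: le_lt_trans i2.
  by apply: ae_ge0_le_integral.
- move=> k [mk pk] ik.
  have : mu.-integrable (times T) k.
    apply/integrableP; split=> //; apply: le_lt_trans ik.
    by under eq_integral do rewrite gee0_abs//.
  move=> /(integrable_ae mT); apply: ae_imp => t h /h /fin_numPlt.
  by case/andP.
Qed.

Lemma mu_times_fin : (mu (times T) < +oo)%E.
Proof.
by rewrite /times lebesgue_measure_itv/=; case: ifPn => _; rewrite -?EFinB ltry.
Qed.

Lemma Linf_L1_size k : admissible k -> Linf_size k -> L1_size k.
Proof.
move=> [mk pk] [M HM]; have mT := measurable_times T.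
have : (\int[mu]_(t in times T) k t <= \int[mu]_(t in times T) `|M|%:E)%E.
  apply: ae_ge0_le_integral => //.
  apply: ae_imp HM => t h Tt; apply: le_trans (h Tt) _.
  by rewrite lee_fin ler_norm.
move=> /le_lt_trans; apply; rewrite integral_cst//.
apply: lte_mul_pinfty => //; exact: mu_times_fin.
Qed.

Section sums.
Variable B : (R -> \bar R) -> Prop.
Hypothesis HB : size_class B.

Lemma admissible_sum (I : Type) (r : seq I) (P : pred I) (k : I -> R -> \bar R) :
  (forall i, P i -> admissible (k i)) ->
  admissible (fun t => \sum_(i <- r | P i) k i t)%E.
Proof.
move=> ak; split; last by move=> t; apply: sume_ge0 => i /ak[].
elim: r => [|i r IH].
  by under eq_fun do rewrite big_nil; exact: measurable_cst.
under eq_fun do rewrite big_cons; case: (boolP (P i)) => // /ak[mk _].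
exact: emeasurable_funD.
Qed.

Lemma size_sum (I : Type) (r : seq I) (P : pred I) (k : I -> R -> \bar R) :
  (forall i, P i -> admissible (k i)) -> (forall i, P i -> B (k i)) ->
  B (fun t => \sum_(i <- r | P i) k i t)%E.
Proof.
move=> ak Bk; elim: r => [|i r IH].
  by under eq_fun do rewrite big_nil; exact: size0.
under eq_fun do rewrite big_cons; case: (boolP (P i)) => // Pi.
by apply: (sizeD HB); [exact: ak|exact: admissible_sum|exact: Bk|].
Qed.

Lemma sqn_admissible g : field_measurable g -> admissible (sqn g).
Proof. by move=> mg; split; [exact: measurable_sqn|exact: sqn_ge0]. Qed.

Lemma size_sqn_le f g h : field_measurable f -> field_measurable g ->
  field_measurable h ->
  (forall i z, h i z ^+ 2 <= f i z ^+ 2 + f i z ^+ 2 + (g i z ^+ 2 + g i z ^+ 2)) ->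
  B (sqn f) -> B (sqn g) -> B (sqn h).
Proof.
move=> mf mg mh hfg Bf Bg.
have D k1 k2 : admissible k1 -> admissible k2 ->
    admissible (fun t => k1 t + k2 t)%E.
  move=> [m1 p1] [m2 p2]; split; first exact: emeasurable_funD.
  by move=> t; rewrite adde_ge0.
have af := sqn_admissible mf; have ag := sqn_admissible mg.
apply: (size_le HB (sqn_admissible mh) (D _ _ (D _ _ af af) (D _ _ ag ag))).
  by apply: aeW => t Tt; exact: le_sqn.
by apply: (sizeD HB (D _ _ af af) (D _ _ ag ag)); exact: (sizeD HB).
Qed.

Definition has_derivative a b (v g : tvfield R) : Prop :=
  [/\ field_measurable g, B (sqn g) &
      {ae mu, forall t : measurableTypeR R, times T t ->
        forall i, is_wD L c d a b (slice v t i) (slice g t i)}].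

Lemma ae_in_L2 g : field_measurable g -> B (sqn g) ->
  {ae mu, forall t : measurableTypeR R, times T t ->
    in_L2 (strip L c d) (slice g t)}.
Proof.
move=> mg Bg; apply: ae_imp (size_fin HB (sqn_admissible mg) Bg) => t h Tt.
exact: sqn_in_L2 (h Tt).
Qed.

Lemma ae_slice_integrable g i : field_measurable g -> B (sqn g) ->
  {ae mu, forall t : measurableTypeR R, times T t ->
    leb2.-integrable (strip L c d) (fun x => (g i (t, x))%:E)}.
Proof.
move=> mg Bg; apply: ae_imp (ae_in_L2 mg Bg) => t h Tt.
exact: (in_L2_integrable i (h Tt)).
Qed.

Lemma has_derivative_wDt k a b (w v g : tvfield R) :
  (forall i, is_wDt T L c d k 0 0 (w i) (v i)) ->
  (forall i, is_wDt T L c d k a b (w i) (g i)) ->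
  B (sqn v) -> B (sqn g) -> has_derivative a b v g.
Proof.
move=> wv wg Bv Bg.
have mv : field_measurable v by move=> i; have [_ ? _] := wv i; exact: locint3_measurable.
have mg : field_measurable g by move=> i; have [_ ? _] := wg i; exact: locint3_measurable.
split => //.
have /ae_forall_ord : forall i, {ae mu, forall t : measurableTypeR R, times T t ->
    is_wD L c d a b (fun x => v i (t, x)) (fun x => g i (t, x))}.
  by move=> i; apply: (ae_is_wD (wv i) (wg i)); exact: ae_slice_integrable.
by apply: ae_imp => t h Tt i; exact: h.
Qed.

Lemma field_measurableD f g : field_measurable f -> field_measurable g ->
  field_measurable (fun i z => f i z + g i z).
Proof. by move=> mf mg i; exact: measurable_funD. Qed.

Lemma field_measurableB f g : field_measurable f -> field_measurable g ->
  field_measurable (fun i z => f i z - g i z).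
Proof. by move=> mf mg i; exact: measurable_funB. Qed.

Lemma size_sqnD f g : field_measurable f -> field_measurable g ->
  B (sqn f) -> B (sqn g) -> B (sqn (fun i z => f i z + g i z)).
Proof.
move=> mf mg; apply: size_sqn_le => //; first exact: field_measurableD.
move=> i z; have := sqr_ge0 (f i z - g i z); rewrite sqrrB sqrrD.
by set x := f i z ^+ 2; set y := g i z ^+ 2; set p := f i z * g i z; lra.
Qed.

Lemma size_sqnB f g : field_measurable f -> field_measurable g ->
  B (sqn f) -> B (sqn g) -> B (sqn (fun i z => f i z - g i z)).
Proof.
move=> mf mg; apply: size_sqn_le => //; first exact: field_measurableB.
move=> i z; have := sqr_ge0 (f i z + g i z); rewrite sqrrB sqrrD.
by set x := f i z ^+ 2; set y := g i z ^+ 2; set p := f i z * g i z; lra.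
Qed.

End sums.

End time_norms.

(** * Elliptic regularity *)

Section elliptic_regularity.
Context {R : realType}.
Variables (T L c d : R).
Local Notation mu := (@lebesgue_measure R).
Variable B : (R -> \bar R) -> Prop.
Hypothesis HB : size_class T B.

Definition Hk_of_size (n : nat) (v : tvfield R) : Prop :=
  exists D, Hk_valued T L c d n v D /\
    B (fun t => sq_Hk (strip L c d) n (fun a b => slice (D a b) t)).

Lemma Hk_of_derivatives n (v : tvfield R) (D : nat -> nat -> tvfield R) :
  D 0%N 0%N = v ->
  (forall a b, (a + b <= n)%N -> has_derivative T L c d B a b v (D a b)) ->
  Hk_of_size n v.
Proof.
move=> D0 HD; exists D; split; last first.
  have adm (a b : nat) : (a + b <= n)%N -> admissible T (sqn L c d (D a b)).
    by move=> /HD[mD _ _]; exact: sqn_admissible.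
  apply: (size_sum HB) => a _; first by apply: admissible_sum => b; exact: adm.
  by apply: (size_sum HB) => b ab; [exact: adm|have [] := HD _ _ ab].
have mv : field_measurable T L c d v by rewrite -D0; have [] := HD 0%N 0%N isT.
split => //; first by move=> a b i /HD[mD _ _]; exact: mD.
have HDab (a b : nat) : (a + b <= n)%N ->
  {ae mu, forall t : measurableTypeR R, times T t ->
    in_L2 (strip L c d) (slice (D a b) t) /\
    forall i, is_wD L c d a b (slice v t i) (slice (D a b) t i)}.
  move=> /HD[mD BD wD].
  apply: (ae_imp2 _ (ae_in_L2 HB mD BD) wD) => t h1 h2 Tt.
  by split; [exact: h1|exact: h2].
have : {ae mu, forall t : measurableTypeR R, forall p : 'I_n.+1 * 'I_n.+1,
    (p.1 + p.2 <= n)%N -> times T t ->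
    in_L2 (strip L c d) (slice (D p.1 p.2) t) /\
    forall i, is_wD L c d p.1 p.2 (slice v t i) (slice (D p.1 p.2) t i)}.
  apply: filter_forall => p; case: (leqP (p.1 + p.2) n) => [pn|pn].
    by apply: ae_imp (HDab _ _ pn) => t h _; exact: h.
  by apply: aeW => t.
apply: ae_imp => t Ht Tt; split; first by rewrite D0.
move=> a b ab.
have an : (a < n.+1)%N by rewrite ltnS (leq_trans _ ab)// leq_addr.
have bn : (b < n.+1)%N by rewrite ltnS (leq_trans _ ab)// leq_addl.
exact: (Ht (Ordinal an, Ordinal bn) ab Tt).
Qed.

(** V and F hold derivatives of v and of its Laplacian; two derivatives in x_2
    are traded for the Laplacian minus two derivatives in x_1. *)
Definition all_derivatives (V F : nat -> nat -> tvfield R) (a b : nat) :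
    tvfield R :=
  if b is b'.+2 then fun i z => F a b' i z - V a.+2 b' i z else V a b.

(** As n <= 3, the derivatives V a.+2 b and F a b that are called for have
    b <= 1: the recursion in b stops after one step. *)
Lemma elliptic_regularity n (v : tvfield R) (V F : nat -> nat -> tvfield R) :
  (n <= 3)%N -> V 0%N 0%N = v ->
  (forall a b, (b <= 1)%N -> (a + b <= n)%N ->
    has_derivative T L c d B a b v (V a b)) ->
  (forall a b, (a + b.+2 <= n)%N ->
    has_derivative T L c d B a b (F 0%N 0%N) (F a b)) ->
  (forall i, {ae mu, forall t : measurableTypeR R, times T t ->
    weak_laplacian L c d (fun x => v i (t, x)) (fun x => F 0%N 0%N i (t, x))}) ->
  Hk_of_size n v.
Proof.
move=> n3 V0 HV HF lap; apply: (@Hk_of_derivatives _ _ (all_derivatives V F)) => //.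
move=> a [|[|b]] ab; [exact: HV|exact: HV|rewrite /all_derivatives].
have b1 : (b <= 1)%N.
  by have := leq_trans (leq_trans (leq_addl a b.+2) ab) n3.
have [mF BF dF] := HF a b ab.
have a2b : (a.+2 + b <= n)%N by rewrite !addSn -!addnS.
have [mV BV dV] := HV a.+2 b b1 a2b.
have [mv Bv _] : has_derivative T L c d B 0 0 v v.
  by rewrite -[X in has_derivative _ _ _ _ _ _ _ _ X]V0; apply: HV.
split; [exact: field_measurableB|exact: (size_sqnB HB)|].
have /ae_forall_ord lap' := lap.
have iv := ae_in_L2 HB mv Bv; have iF := ae_in_L2 HB mF BF.
have iV := ae_in_L2 HB mV BV.
have H1 := ae_imp2 (fun t x y => conj x y) iv (ae_imp2 (fun t x y => conj x y) iF iV).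
have H2 := ae_imp2 (fun t x y => conj x y) dF dV.
apply: ae_imp2 (ae_imp2 (fun t x y => conj x y) H1 H2) lap'.
move=> t [[h1 [h2 h3]] [h4 h5]] h6 Tt i.
apply: (@weak_laplacian_is_wD _ _ _ _ _ _ _ _ _ _ (h6 i Tt) (h4 Tt i) (h5 Tt i)).
- exact: (in_L2_integrable i (h1 Tt)).
- exact: (in_L2_integrable i (h2 Tt)).
- exact: (in_L2_integrable i (h3 Tt)).
Qed.

End elliptic_regularity.

(** * Extraction of the derivatives from the energy estimates *)

Section estimates.
Context {R : realType}.
Variables (T L : R).
Hypothesis T0 : 0 < T.
Local Notation mu := (@lebesgue_measure R).

Lemma Hk_of_Linf c d n v : Hk_of_size T L c d (Linf_size T) n v ->
  in_LinfHk T L c d n v.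
Proof.
move=> [D [HD [M HM]]]; exists D; split => //.
rewrite /Linf_bounded /esssup (@le_lt_trans _ _ (Num.max M 0)%:E)// ?ltry//.
apply/ess_supP; apply: ae_imp HM => t Ht; rewrite /patch.
case: ifPn => [/set_mem/Ht h|_]; last by rewrite lee_fin le_max lexx orbT.
by apply: le_trans h _; rewrite lee_fin le_max lexx.
Qed.

Lemma Hk_of_L1 c d n v : Hk_of_size T L c d (L1_size T) n v ->
  in_L2Hk T L c d n v.
Proof. by move=> [D [HD H]]; exists D. Qed.

Lemma times_ae_inhabited (P : R -> Prop) :
  {ae mu, forall t : measurableTypeR R, times T t -> P t} ->
  exists2 t, times T t & P t.
Proof.
move=> H; apply: contrapT => nP.
have [N [mN N0 sN]] : {ae mu, forall t : measurableTypeR R, ~ times T t}.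
  by apply: ae_imp H => t h Tt; apply: nP; exists t => //; exact: h.
have TN : times T `<=` N by move=> t Tt; apply: sN => /(_ Tt).
have : (mu (times T) <= mu N)%E.
  by apply: le_measure => //; rewrite inE//; exact: measurable_times.
by rewrite N0 /times lebesgue_measure_itv/= lte_fin T0 -EFinB subr0 lee_fin leNgt T0.
Qed.

(** The representative on which sq_D is evaluated. *)
Definition chosen c d k a b (v : tvfield R) : tvfield R :=
  xget v (wDts T L c d k a b v).

Lemma sq_D_chosen c d k a b v : wDts T L c d k a b v !=set0 ->
  sq_D T L c d k a b v = sqn L c d (chosen c d k a b v).
Proof. by move=> H; apply/funext => t; rewrite /sq_D; case: asboolP. Qed.

Lemma wDts_measurable c d k a b v g : wDts T L c d k a b v g ->
  field_measurable T L c d g.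
Proof. by move=> vg i; have [_ ? _] := vg i; exact: locint3_measurable. Qed.

Lemma sq_D_ge0 c d k a b v t : (0 <= sq_D T L c d k a b v t)%E.
Proof. by rewrite /sq_D; case: asboolP => // _; exact: (@sqn_ge0 _ L c d). Qed.

Lemma sq_D_admissible c d k a b v : admissible T (sq_D T L c d k a b v).
Proof.
split; last exact: sq_D_ge0.
have [ne|ne] := pselect (wDts T L c d k a b v !=set0).
  rewrite sq_D_chosen//; apply: measurable_sqn.
  by apply: (@wDts_measurable _ _ k a b v); exact: (xgetPex v ne).
rewrite (_ : sq_D T L c d k a b v = cst +oo%E); first exact: measurable_cst.
by apply/funext => t; rewrite /sq_D; case: asboolP.
Qed.

Lemma admissibleD (k1 k2 : R -> \bar R) : admissible T k1 -> admissible T k2 ->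
  admissible T (fun t => k1 t + k2 t)%E.
Proof.
move=> [m1 p1] [m2 p2]; split; first exact: emeasurable_funD.
by move=> t; rewrite adde_ge0.
Qed.

Definition derivative_of_size B c d k a b (v : tvfield R) : Prop :=
  (forall i, is_wDt T L c d k a b (v i) (chosen c d k a b v i)) /\
  B (sqn L c d (chosen c d k a b v)).

(** Where no derivative exists sq_D is +oo at all times, which a bound
    excludes. *)
Lemma sq_D_derivative B c d k a b v : size_class T B ->
  B (sq_D T L c d k a b v) -> derivative_of_size B c d k a b v.
Proof.
move=> HB BD.
have [t _] := times_ae_inhabited (size_fin HB (sq_D_admissible c d k a b v) BD).
rewrite {1}/sq_D; case: asboolP => // ne _.
split; last by rewrite -sq_D_chosen.
exact: (xgetPex v ne).
Qed.

Lemma lee_term (I : finType) (f : I -> \bar R) i :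
  (forall j, 0 <= f j)%E -> (f i <= \sum_j f j)%E.
Proof. by move=> f0; rewrite (bigD1 i)//= leeDl// sume_ge0. Qed.

Section energy.
Variables (h1 h2 C : R) (k m : nat) (u w : tvfield R).
Hypothesis est : energy_estimate T L h1 h2 k m u w C.

Let total (al : nat) (t : R) : \bar R :=
  (sq_D T L h1 h2 k al 0 u t + sq_D T L 0 h1 k.+1 al 0 w t
   + sq_DH1 T L 0 h1 k al w t)%E.

Let total_adm al : admissible T (total al).
Proof.
apply: admissibleD; first by apply: admissibleD; exact: sq_D_admissible.
by apply: admissibleD; first apply: admissibleD; exact: sq_D_admissible.
Qed.

Let grad_adm al : admissible T (sq_Dgrad T L h1 h2 k al u).
Proof. by apply: admissibleD; exact: sq_D_admissible. Qed.

Let sup_bound : Linf_size T (fun t => \sum_(al < m.+1) total al t)%E.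
Proof.
exists C.
have I0 : (0 <= \int[mu]_(t in times T)
    \sum_(al < m.+1) sq_Dgrad T L h1 h2 k al u t)%E.
  apply: integral_ge0 => t _; apply: sume_ge0 => al _.
  by have [_] := grad_adm al.
have := le_trans (leeDl _ I0) est; rewrite /esssup => /ess_supP.
by apply: ae_imp => t + Tt; rewrite /patch mem_set.
Qed.

(* The essential supremum in the estimate is nonnegative because (0, T) is not
   a null set; hence the integral is bounded as well. *)
Let int_bound : L1_size T (fun t => \sum_(al < m.+1) sq_Dgrad T L h1 h2 k al u t)%E.
Proof.
have S0 : (0 <= esssup T (fun t => \sum_(al < m.+1) total al t))%E.
  apply: ess_sup_gee.
    apply: (@lt_le_trans _ _ (mu (times T))).
      by rewrite /times lebesgue_measure_itv/= lte_fin T0 -EFinB subr0 lte_fin.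
    by apply: le_measure => //; rewrite inE//; exact: measurable_times.
  apply: aeW => t; rewrite /patch; case: ifPn => // _; apply: sume_ge0 => al _.
  by have [_] := total_adm al.
by apply: le_lt_trans (le_trans (leeDr _ S0) est) _; rewrite ltry.
Qed.

Let Linf_term al (f : R -> \bar R) : (al <= m)%N -> admissible T f ->
  (forall t, f t <= total al t)%E -> Linf_size T f.
Proof.
move=> alm af fS.
apply: (size_le (Linf_size_class T) af _ _ sup_bound).
  by apply: admissible_sum => i _; exact: total_adm.
apply: aeW => t _; apply: le_trans (fS t) _.
apply: (@lee_term _ (fun al : 'I_m.+1 => total al t) (Ordinal (alm : (al < m.+1)%N))).
by move=> j; have [_] := total_adm j.
Qed.

Let L1_term al (f : R -> \bar R) : (al <= m)%N -> admissible T f ->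
  (forall t, f t <= sq_Dgrad T L h1 h2 k al u t)%E -> L1_size T f.
Proof.
move=> alm af fS.
apply: (size_le (L1_size_class T) af _ _ int_bound).
  by apply: admissible_sum => i _; exact: grad_adm.
apply: aeW => t _; apply: le_trans (fS t) _.
apply: (@lee_term _ (fun al : 'I_m.+1 => sq_Dgrad T L h1 h2 k al u t)
  (Ordinal (alm : (al < m.+1)%N))).
by move=> j; have [_] := grad_adm j.
Qed.

Lemma energy_Linf al : (al <= m)%N ->
  [/\ derivative_of_size (Linf_size T) h1 h2 k al 0 u,
      derivative_of_size (Linf_size T) 0 h1 k.+1 al 0 w,
      derivative_of_size (Linf_size T) 0 h1 k al 0 w,
      derivative_of_size (Linf_size T) 0 h1 k al.+1 0 w &
      derivative_of_size (Linf_size T) 0 h1 k al 1 w].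
Proof.
move=> alm; have p c d k' a b v t := sq_D_ge0 c d k' a b v t.
split; apply: (sq_D_derivative (Linf_size_class T));
  apply: (Linf_term alm (sq_D_admissible _ _ _ _ _ _)) => t;
  rewrite /total /sq_DH1.
- by rewrite -addeA leeDl// !adde_ge0.
- by rewrite addeAC leeDr// !adde_ge0.
- rewrite -[leLHS]add0e; apply: leeD; first by rewrite adde_ge0.
  by rewrite -addeA leeDl// adde_ge0.
- rewrite -[leLHS]add0e; apply: leeD; first by rewrite adde_ge0.
  by rewrite addeAC leeDr// adde_ge0.
- by rewrite addeA leeDr// !adde_ge0.
Qed.

Lemma energy_L1 al : (al <= m)%N ->
  derivative_of_size (L1_size T) h1 h2 k al.+1 0 u /\
  derivative_of_size (L1_size T) h1 h2 k al 1 u.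
Proof.
move=> alm; have p c d k' a b v t := sq_D_ge0 c d k' a b v t.
split; apply: (sq_D_derivative (L1_size_class T));
  apply: (L1_term alm (sq_D_admissible _ _ _ _ _ _)) => t; rewrite /sq_Dgrad.
- by rewrite leeDl.
- by rewrite leeDr.
Qed.

End energy.

End estimates.

(** * Regularity of the heat and wave components *)

Section regularity.
Context {R : realType}.
Variables (T L : R).

Lemma is_wDt_refl c d (v : R * (R * R) -> R) : locint3 T L c d v ->
  is_wDt T L c d 0 0 0 v v.
Proof. by move=> iv; split => // f _; rewrite expr0 mul1r. Qed.

Lemma is_wDD c d a b (f f' g g' : R * R -> R) :
  leb2.-integrable (strip L c d) (EFin \o f) ->
  leb2.-integrable (strip L c d) (EFin \o f') ->
  leb2.-integrable (strip L c d) (EFin \o g) ->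
  leb2.-integrable (strip L c d) (EFin \o g') ->
  is_wD L c d a b f f' -> is_wD L c d a b g g' ->
  is_wD L c d a b (fun x => f x + g x) (fun x => f' x + g' x).
Proof.
move=> if_ if' ig ig' [_ _ Ef] [_ _ Eg]; have mS := measurable_strip L c d.
have iD (p q : R * R -> R) : leb2.-integrable (strip L c d) (EFin \o p) ->
    leb2.-integrable (strip L c d) (EFin \o q) ->
    leb2.-integrable (strip L c d) (EFin \o (fun x => p x + q x)).
  move=> ip iq; have := integrableD mS ip iq.
  by apply: eq_integrable => // x _; rewrite /= EFinD.
have RD (p q h : R * R -> R) : leb2.-integrable (strip L c d) (EFin \o p) ->
    leb2.-integrable (strip L c d) (EFin \o q) -> smooth h ->
    \int[leb2]_(x in strip L c d) ((p x + q x) * h x) =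
    \int[leb2]_(x in strip L c d) (p x * h x) +
    \int[leb2]_(x in strip L c d) (q x * h x).
  move=> ip iq Ch; under eq_Rintegral do rewrite mulrDl.
  exact: (RintegralD mS (integrable_mul_smooth Ch ip) (integrable_mul_smooth Ch iq)).
split; [exact/integrable_locint2/iD|exact/integrable_locint2/iD|move=> h th].
have [Ch _ _] := th.
rewrite (RD _ _ _ if_ ig (smooth_pD a b Ch)) (RD _ _ _ if' ig' Ch) mulrDr.
by rewrite -(Ef _ th) -(Eg _ th).
Qed.

Lemma has_derivativeD c d B a b (f f' g g' : tvfield R) : size_class T B ->
  field_measurable T L c d f -> B (sqn L c d f) ->
  field_measurable T L c d g -> B (sqn L c d g) ->
  has_derivative T L c d B a b f f' -> has_derivative T L c d B a b g g' ->
  has_derivative T L c d B a b (fun i z => f i z + g i z)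
    (fun i z => f' i z + g' i z).
Proof.
move=> HB mf Bf mg Bg [mf' Bf' df] [mg' Bg' dg].
split; [exact: field_measurableD|exact: (size_sqnD HB)|].
have H1 := ae_imp2 (fun t x y => conj x y) (ae_in_L2 HB mf Bf) (ae_in_L2 HB mf' Bf').
have H2 := ae_imp2 (fun t x y => conj x y) (ae_in_L2 HB mg Bg) (ae_in_L2 HB mg' Bg').
have H3 := ae_imp2 (fun t x y => conj x y) df dg.
apply: ae_imp2 (ae_imp2 (fun t x y => conj x y) H1 H2) H3.
move=> t [[h1 h2] [h3 h4]] [h5 h6] Tt i.
exact: (is_wDD (in_L2_integrable i (h1 Tt)) (in_L2_integrable i (h2 Tt))
  (in_L2_integrable i (h3 Tt)) (in_L2_integrable i (h4 Tt)) (h5 Tt i) (h6 Tt i)).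
Qed.

Lemma Linf_size_field c d k (v : tvfield R) D : Hk_valued T L c d k v D ->
  Linf_bounded T L c d k D -> Linf_size T (sqn L c d v).
Proof.
move=> [_ _ vD]; rewrite /Linf_bounded /esssup; set S := ess_sup _ _ => Sfin.
have [M SM] : exists M : R, (S <= M%:E)%E.
  by case: S Sfin => [r| |] // _; [exists r|exists 0; exact: leNye].
exists M; have := ess_sup_ge (@lebesgue_measure R) (patch (cst 0%E) (times T)
  (fun t => sq_Hk (strip L c d) k (fun a b => slice (D a b) t))).
apply: ae_imp2 vD => t vt Ht Tt; have [E _] := vt Tt.
apply: le_trans (le_trans Ht SM); rewrite /patch mem_set//.
rewrite /sqn -E /sq_Hk (bigD1 ord0)//= (bigD1 ord0)//= -addeA leeDl//.
have p a b : (0 <= sq_L2 (strip L c d) (slice (D a b) t))%E.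
  exact: (sqn_ge0 L c d (D a b) t).
by rewrite adde_ge0// sume_ge0// => i _; rewrite ?sume_ge0.
Qed.

(** The derivative of order zero has to be the given function itself, whereas
    the estimates speak of another representative of its class. *)
Definition with_zeroth (v : tvfield R) (G : nat -> nat -> tvfield R) (a b : nat) :
    tvfield R :=
  if (a + b == 0)%N then v else G a b.

Lemma has_derivative_with_zeroth c d B k a b (w v : tvfield R) : size_class T B ->
  (forall i, is_wDt T L c d k 0 0 (w i) (v i)) -> B (sqn L c d v) ->
  derivative_of_size T L B c d k a b w ->
  has_derivative T L c d B a b v (with_zeroth v (fun a b => chosen T L c d k a b w) a b).
Proof.
move=> HB wv Bv [wg Bg]; rewrite /with_zeroth; case: ifPn => [|_].
  rewrite addn_eq0 => /andP[/eqP-> /eqP->].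
  exact: (has_derivative_wDt HB wv wv Bv Bv).
exact: (has_derivative_wDt HB wv wg Bv Bg).
Qed.

(** Here v is the k-th time derivative of w, and its Laplacian is the
    (k + 2)-nd one plus v: the equation for the moments of w is differentiated k
    times in t. *)
Lemma wave_Hk c d k n (w v : tvfield R) : (n <= 3)%N ->
  (forall i h, test2 L c d h -> time_derivative T 2 (moment L c d (w i) h)
    (fun t => moment L c d (w i) (pD 2 0 h) t
      + moment L c d (w i) (pD 0 2 h) t + -1 * moment L c d (w i) h t)) ->
  (forall i, is_wDt T L c d k 0 0 (w i) (v i)) ->
  Linf_size T (sqn L c d v) ->
  (forall a b, (b <= 1)%N -> (a + b <= n)%N ->
    derivative_of_size T L (Linf_size T) c d k a b w) ->
  (forall a b, (a + b.+2 <= n)%N ->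
    derivative_of_size T L (Linf_size T) c d (2 + k) a b w) -> (2 <= n)%N ->
  in_LinfHk T L c d n v.
Proof.
move=> n3 wave wv Bv HV HF n2; have HB := Linf_size_class T.
pose V := with_zeroth v (fun a b => chosen T L c d k a b w).
pose G (a b : nat) := chosen T L c d (2 + k) a b w.
pose F (a b : nat) : tvfield R := fun i z => G a b i z + V a b i z.
have wG : wDts T L c d (2 + k) 0 0 w (G 0%N 0%N) by have [] := HF 0%N 0%N n2.
have BG : Linf_size T (sqn L c d (G 0%N 0%N)) by have [] := HF 0%N 0%N n2.
have mG := wDts_measurable wG; have mv := @wDts_measurable _ T L c d k 0 0 w v wv.
apply: Hk_of_Linf.
apply: (elliptic_regularity HB (V := V) (F := F) n3 (erefl v))
  => [a b b1 ab|a b ab|i].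
- exact: (has_derivative_with_zeroth HB wv Bv (HV _ _ b1 ab)).
- have b1 : (b <= 1)%N by have := leq_trans (leq_trans (leq_addl a b.+2) ab) n3.
  have ab' : (a + b <= n)%N by apply: leq_trans ab; rewrite !addnS ltnW.
  have [wGab BGab] := HF a b ab.
  apply: (has_derivativeD HB mG BG mv Bv).
    exact: (has_derivative_wDt HB wG wGab BG BGab).
  exact: (has_derivative_with_zeroth HB wv Bv (HV _ _ b1 ab')).
- have iv := ae_slice_integrable HB i mv Bv.
  have iG := ae_slice_integrable HB i mG BG.
  apply: (ae_weak_laplacian iv).
    apply: ae_imp2 iG iv => t h1 h2 Tt.
    have := integrableD (measurable_strip L c d) (h1 Tt) (h2 Tt).
    apply: eq_integrable; first exact: measurable_strip.
    by move=> x _; rewrite /F /V /= EFinD.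
  move=> h th.
  have A := time_derivative_cancel (wave i h th) (is_wDt_time_derivative0 (wG i) th).
  have vd a b := is_wDt_time_derivative0 (wv i) (test2_pD a b th).
  have v0 := is_wDt_time_derivative0 (wv i) th.
  have C := time_derivativeD (time_derivativeD (vd 2 0)%N (vd 0 2)%N)
    (time_derivativeZ (-1) v0).
  have AC := time_derivative_unique A C.
  apply: ae_imp2 (ae_imp2 (fun t x y => conj x y) iv iG) AC => t [h1 h2] E Tt.
  have [Ch _ _] := th.
  have -> : moment L c d (F 0%N 0%N i) h t =
      moment L c d (G 0%N 0%N i) h t + moment L c d (v i) h t.
    rewrite /moment -(RintegralD (measurable_strip L c d)
      (integrable_mul_smooth Ch (h2 Tt)) (integrable_mul_smooth Ch (h1 Tt))).
    by apply: eq_Rintegral => x _; rewrite /F /V /with_zeroth /= mulrDl.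
  by rewrite (E Tt) mulN1r subrK.
Qed.

(** The Laplacian of u is its first time derivative. *)
Lemma heat_Hk c d (u : tvfield R) : (forall i, locint3 T L c d (u i)) ->
  (forall i h, test2 L c d h -> time_derivative T 1 (moment L c d (u i) h)
    (fun t => moment L c d (u i) (pD 2 0 h) t
      + moment L c d (u i) (pD 0 2 h) t)) ->
  L1_size T (sqn L c d u) ->
  (forall a b, (b <= 1)%N -> (a + b <= 3)%N ->
    derivative_of_size T L (L1_size T) c d 0 a b u) ->
  (forall a b, (a + b.+2 <= 3)%N ->
    derivative_of_size T L (L1_size T) c d 1 a b u) ->
  in_L2Hk T L c d 3 u.
Proof.
move=> iu heat Bu HV HF; have HB := L1_size_class T.
have uu i : is_wDt T L c d 0 0 0 (u i) (u i) by exact: is_wDt_refl.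
pose V := with_zeroth u (fun a b => chosen T L c d 0 a b u).
pose F (a b : nat) := chosen T L c d 1 a b u.
have uF : wDts T L c d 1 0 0 u (F 0%N 0%N) by have [] := HF 0%N 0%N isT.
have BF : L1_size T (sqn L c d (F 0%N 0%N)) by have [] := HF 0%N 0%N isT.
have mF := wDts_measurable uF; have meas_u := @wDts_measurable _ T L c d 0 0 0 u u uu.
apply: Hk_of_L1.
apply: (@elliptic_regularity _ _ _ _ _ _ HB 3 u V F isT (erefl u))
  => [a b b1 ab|a b ab|i].
- exact: (has_derivative_with_zeroth HB uu Bu (HV _ _ b1 ab)).
- have [wFab BFab] := HF a b ab.
  exact: (has_derivative_wDt HB uF wFab BF BFab).
- apply: (ae_weak_laplacian (ae_slice_integrable HB i meas_u Bu)
    (ae_slice_integrable HB i mF BF)) => h th.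
  exact: (time_derivative_unique (heat i h th) (is_wDt_time_derivative0 (uF i) th)).
Qed.

Lemma derivative_of_L1 c d k a b (v : tvfield R) :
  derivative_of_size T L (Linf_size T) c d k a b v ->
  derivative_of_size T L (L1_size T) c d k a b v.
Proof.
move=> [vG BG]; split => //; apply: Linf_L1_size BG.
by apply: sqn_admissible; exact: wDts_measurable vG.
Qed.

End regularity.

Theorem theorem4p4 (R : realType) (L h1 h2 T C : R) (s : nat)
  (L_gt0 : 0 < L) (h1_gt0 : 0 < h1) (h1_lt_h2 : h1 < h2) (T_gt0 : 0 < T)
  (s_ge3 : (3 <= s)%N) (u w wt : 'I_2 -> R * (R * R) -> R)
  (sol : weak_solution T L h1 h2 u w wt)
  (est0 : energy_estimate T L h1 h2 0 s u w C)
  (est1 : energy_estimate T L h1 h2 1 (s - 1) u w C)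
  (est2 : energy_estimate T L h1 h2 2 (s - 2) u w C) :
  [/\ in_LinfHk T L 0 h1 3 w,
      in_LinfHk T L 0 h1 2 wt &
      in_L2Hk T L h1 h2 3 u].
Proof.
case: s s_ge3 est0 est1 est2 => [|[|[|s]]]// _ est0 est1 est2.
rewrite !subSS subn0 in est1; rewrite !subSS subn0 in est2.
(* With k time derivatives, the orders up to 3 - k in x_1 are kept; E is for
   bounds uniform in time, G for integrated ones. *)
have E0 (al : nat) (h : (al <= 3)%N) :=
  energy_Linf T_gt0 est0 (leq_trans h (leq_addr s 3)).
have G0 (al : nat) (h : (al <= 3)%N) :=
  energy_L1 T_gt0 est0 (leq_trans h (leq_addr s 3)).
have E1 (al : nat) (h : (al <= 2)%N) :=
  energy_Linf T_gt0 est1 (leq_trans h (leq_addr s 2)).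
have G1 (al : nat) (h : (al <= 2)%N) :=
  energy_L1 T_gt0 est1 (leq_trans h (leq_addr s 2)).
have E2 (al : nat) (h : (al <= 1)%N) :=
  energy_Linf T_gt0 est2 (leq_trans h (leq_addr s 1)).
have iu i : locint3 T L h1 h2 (u i).
  by have [[/(_ i)[]]] := E0 0%N isT.
have [[Du0 [Hu0 Bu0]] [Dz0 [Hz0 Bz0]] wz [Du [Dw [F [_ [Hw Bw] _ _ _]]]]] := sol.
have wave := wave_moments L_gt0 h1_gt0 h1_lt_h2 sol iu.
split.
- apply: (wave_Hk (k := 0) (leqnn 3) wave) => // [i| |a [|[|b]]// _ ab|a [|[|b]]//].
  + by apply: is_wDt_refl; have [] := wz i.
  + exact: Linf_size_field Hw Bw.
  + rewrite addn0 in ab; have [_ _ h _ _] := E0 a ab; exact: h.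
  + rewrite addn1 in ab; have [_ _ _ _ h] := E0 a (ltnW ab); exact: h.
  + rewrite addn2 !ltnS => a1; have [_ _ h _ _] := E2 a a1; exact: h.
  + rewrite addn3 !ltnS leqn0 => /eqP ->; have [_ _ _ _ h] := E2 0%N isT; exact: h.
  + by rewrite !addnS !ltnS ltn0.
- apply: (wave_Hk (k := 1) (isT : (2 <= 3)%N) wave wz) => // [|a [|[|b]]// _ ab|a b].
  + exact: Linf_size_field Hz0 Bz0.
  + rewrite addn0 in ab; have [_ _ h _ _] := E1 a ab; exact: h.
  + rewrite addn1 in ab; have [_ _ _ _ h] := E1 a (ltnW ab); exact: h.
  + rewrite !addnS !ltnS leqn0 addn_eq0 => /andP[/eqP-> /eqP->].
    have [_ h _ _ _] := E2 0%N isT; exact: h.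
- apply: (heat_Hk iu (heat_moments L_gt0 h1_gt0 h1_lt_h2 sol iu))
    => [|a [|[|b]]// _ ab|a [|[|b]]//].
  + apply: Linf_L1_size (Linf_size_field Hu0 Bu0).
    by apply: sqn_admissible; case: Hu0.
  + rewrite addn0 in ab; apply: derivative_of_L1.
    have [h _ _ _ _] := E0 a ab; exact: h.
  + rewrite addn1 in ab; have [_ h] := G0 a (ltnW ab); exact: h.
  + rewrite addn2 !ltnS => a1; apply: derivative_of_L1.
    have [h _ _ _ _] := E1 a (leqW a1); exact: h.
  + rewrite addn3 !ltnS leqn0 => /eqP ->; have [_ h] := G1 0%N isT; exact: h.
  + by rewrite !addnS !ltnS ltn0.
Qed.
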